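(* Let $\Omega\subset\mathbb{R}^2$ be a bounded domain with $C^3$ boundary. Then there exist $\overline{\delta}>0$ and a constant $C>0$ (independent of $\delta$ and $\mathbf{x}$) such that for every $0<\delta\le\overline{\delta}$ and every $\mathbf{x}\in\mathcal{I}\Omega_N$ the matrix $$\mathbf{A}(\mathbf{x}):=\frac{d}{m(\delta)}\int_{B_\delta(\mathbf{x})\cap\Omega}K(|\mathbf{y}-\mathbf{x}|)\,(\mathbf{y}-\mathbf{x})\otimes(\mathbf{y}-\mathbf{x})\,d\mathbf{y}$$ is invertible, so that the correction tensor $\mathbf{M}(\mathbf{x})=\mathbf{A}(\mathbf{x})^{-1}$ is a well-defined symmetric matrix. Moreover, writing matrices in the orthonormal basis $(\mathbf{p},\mathbf{n})=(\mathbf{p}(\overline{\mathbf{x}}),\mathbf{n}(\overline{\mathbf{x}}))$, with $$a_{pp}=\frac{d}{m(\delta)}\int_{B_\delta(\mathbf{x})\cap\Omega}K\,((\mathbf{y}-\mathbf{x})\cdot\mathbf{p})^2d\mathbf{y},\quad a_{nn}=\frac{d}{m(\delta)}\int_{B_\delta(\mathbf{x})\cap\Omega}K\,((\mathbf{y}-\mathbf{x})\cdot\mathbf{n})^2d\mathbf{y},$$ $$a_{pn}=\frac{d}{m(\delta)}\int_{B_\delta(\mathbf{x})\cap\Omega}K\,((\mathbf{y}-\mathbf{x})\cdot\mathbf{p})((\mathbf{y}-\mathbf{x})\cdot\mathbf{n})d\mathbf{y},$$ one has $|a_{pn}|\le C\delta^2$, and $$\mathbf{M}(\mathbf{x})=\begin{pmatrix}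 a_{pp}^{-1}+O(\delta^4) & O(\delta^2)\\ O(\delta^2) & a_{nn}^{-1}+O(\delta^4)\end{pmatrix},$$ where each $O(\delta^k)$ denotes a quantity bounded in absolute value by $C\delta^k$.
   Context: Dimension $d=2$. For a horizon $\delta>0$, $B_\delta(\mathbf{x})$ is the ball of radius $\delta$ centered at $\mathbf{x}$. The kernel is $K(r)=1/r$ for $0<r\le\delta$ and $K(r)=0$ for $r>\delta$; we write $K$ for $K(|\mathbf{y}-\mathbf{x}|)$. The weighted volume is $m(\delta)=\int_{B_\delta(\mathbf{x})}K(|\mathbf{y}-\mathbf{x}|)|\mathbf{y}-\mathbf{x}|^2d\mathbf{y}=2\pi\delta^3/3$. The boundary is split as $\partial\Omega=\partial\Omega_D\cup\partial\Omega_N$ with disjoint relative interiors (both are curves). $\mathcal{I}\Omega_N:=\{\mathbf{x}\in\Omega:\operatorname{dist}(\mathbf{x},\partial\Omega_N)<\delta\}$. It is assumed $\delta$ is small enough that each $\mathbf{x}\in\mathcal{I}\Omega_N$ has a unique orthogonal projection $\overline{\mathbf{x}}$ onto $\partial\Omega_N$, with $\overline{\mathbf{x}}-\mathbf{x}=s_x\mathbf{n}(\overline{\mathbf{x}})$, $0<s_x<\delta$; $\mathbf{n}(\overline{\mathbf{x}})$ is the outward unit normal and $\mathbf{p}(\overline{\mathbf{x}})$ the unit tangent at $\overline{\mathbf{x}}$. *)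

(* Defs.v *)
From HB Require Import structures.
From mathcomp Require Import all_boot all_order all_algebra.
From mathcomp Require Import all_classical all_reals all_analysis.
Set Implicit Arguments. Unset Strict Implicit. Unset Printing Implicit Defensive.
Import Order.TTheory GRing.Theory Num.Theory.
Import numFieldNormedType.Exports.
Local Open Scope classical_set_scope.
Local Open Scope ring_scope.

Section Defs.
Variable R : realType.

(* Points of R^2 are pairs; Euclidean structure written out explicitly
   (the library norm on R * R is the max-norm). *)
Definition pt := (R * R)%type.
Definition vsub (y x : pt) : pt := (y.1 - x.1, y.2 - x.2).
Definition vadd (x : pt) (s : R) (v : pt) : pt := (x.1 + s * v.1, x.2 + s * v.2).
Definition dot (u v : pt) : R := u.1 * v.1 + u.2 * v.2.
Definition enorm (u : pt) : R := Num.sqrt (dot u u).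
Definition perp (u : pt) : pt := (- u.2, u.1).
Definition coord (i : 'I_2) (u : pt) : R := if val i == 0%N then u.1 else u.2.
Definition colv (u : pt) : 'cV[R]_2 := \col_(i < 2) coord i u.

Definition Ck (k : nat) (f : R -> R) : Prop :=
  (forall i, (i < k)%N -> forall t : R, derivable (derive1n i f) t 1) /\
  continuous (derive1n k f).

Definition boundary (O : set pt) : set pt := closure O `\` interior O.

(* Local graph chart of class C^k at the boundary point b, in the orthonormal
   frame (perp e, e): near b, O lies strictly "below" the graph of g, e points
   outward. *)
Definition graph_chart (k : nat) (O : set pt) (b e : pt) : Prop :=
  enorm e = 1 /\
  exists (r : R) (g : R -> R), 0 < r /\ g 0 = 0 /\ Ck k g /\
    forall y, enorm (vsub y b) < r ->
      (O y <-> dot (vsub y b) e < g (dot (vsub y b) (perp e))).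

Definition C3_bounded_domain (O : set pt) : Prop :=
  O !=set0 /\ open O /\ connected O /\
  (exists M : R, forall y, O y -> enorm y <= M) /\
  (forall b, boundary O b -> exists e, graph_chart 3 O b e).

(* e is the outward unit normal of O at b: O is locally the subgraph of a C^1
   function which is flat at b, in the frame (perp e, e). *)
Definition outward_unit_normal (O : set pt) (b e : pt) : Prop :=
  boundary O b /\ enorm e = 1 /\
  exists (r : R) (g : R -> R), 0 < r /\ g 0 = 0 /\ Ck 1 g /\ derive1 g 0 = 0 /\
    forall y, enorm (vsub y b) < r ->
      (O y <-> dot (vsub y b) e < g (dot (vsub y b) (perp e))).

Definition leb2 := ((@lebesgue_measure R) \x (@lebesgue_measure R))%E.

Definition Kern (delta r : R) : R := if (0 < r) && (r <= delta) then r^-1 else 0.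

Definition mvol (delta : R) : R := 2 * pi * delta ^+ 3 / 3.

Definition ballE (x : pt) (delta : R) : set pt := [set y | enorm (vsub y x) <= delta].

Definition wint (O : set pt) (delta : R) (x : pt) (f : pt -> R) : R :=
  2 / mvol delta *
  Rintegral leb2 (ballE x delta `&` O)
    (fun y => Kern delta (enorm (vsub y x)) * f (vsub y x)).

Definition Amat (O : set pt) (delta : R) (x : pt) : 'M[R]_2 :=
  \matrix_(i < 2, j < 2) wint O delta x (fun z => coord i z * coord j z).

Definition bil (A : 'M[R]_2) (u v : pt) : R := ((colv u)^T *m A *m colv v) ord0 ord0.

End Defs.

(* Main.v *)
(* Fix a boundary point with outward normal n, tangent p, and write points near
   it as b + a p + t n.  Taylor expansion of a C^3 chart shows that membership
   in Omega is decided by the sign of t - kap a^2 up to an error C rho^3, where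
   rho is the distance to b; compactness of the boundary makes C uniform.
   On the parabolic model region {t < kap a^2} of the ball, the integrand of
   a_pn is odd in a, so its integral vanishes.  Omega and the model differ in
   the ball only inside a curved strip of area O(delta^4), where the integrand
   is at most delta; dividing by m(delta) ~ delta^3 gives a_pn = O(delta^2).
   A fixed square of side delta/8 inside the ball lies in Omega and keeps a_pp
   and a_nn away from 0, and the 2x2 inverse gives the rest:
   M_pp - 1/a_pp = a_pn^2 / (a_pp det A), M_pn = - a_pn / det A. *)

(* The model has to be a parabola: against the tangent line the strip would have area of order
   delta^3, and only a_pn = O(delta) would follow. The main obstacle is uniformity. The chart at a
   boundary point [b0] has an axis [e] that need not be normal even at [b0], while the normal at a
   nearby [b] is certified by a different graph that is merely C^1. The normal must therefore be
   identified with the normalised gradient of the C^3 chart before the expansion can be rewritten in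
   the frame of [b]. No implicit equation is solved for the new graph. Membership is kept as n - kap
   a^2 < error, where the error still contains the normal coordinate n; that part is absorbed on the
   left for small rho. Passing to frames requires rotation invariance of the product measure, which
   is obtained from shears and coordinate swaps. *)
Require Import Defs.
From HB Require Import structures.
From mathcomp Require Import all_boot all_order all_algebra.
From mathcomp Require Import all_classical all_reals all_analysis.
From mathcomp Require Import measurable_realfun.
From mathcomp Require Import ring lra.
Set Implicit Arguments. Unset Strict Implicit. Unset Printing Implicit Defensive.
Import Order.TTheory GRing.Theory Num.Theory.
Import numFieldNormedType.Exports.
Local Open Scope classical_set_scope.
Local Open Scope ring_scope.

(** * Euclidean plane and Taylor bounds *)

Section euclid.
Variable R : realType.
Implicit Types u v w : pt R.

Lemma enorm_ge0 u : 0 <= enorm u.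
Proof. exact: sqrtr_ge0. Qed.

Lemma dot_ge0 u : 0 <= dot u u.
Proof. by rewrite /dot addr_ge0// -expr2 sqr_ge0. Qed.

Lemma enorm_sq u : enorm u ^+ 2 = dot u u.
Proof. by rewrite sqr_sqrtr// dot_ge0. Qed.

Lemma enorm_le u (c : R) : 0 <= c -> dot u u <= c ^+ 2 -> enorm u <= c.
Proof. by move=> c0 uc; rewrite -[c]ger0_norm// -sqrtr_sqr ler_wsqrtr. Qed.

Lemma dot_unit u : enorm u = 1 -> u.1 * u.1 + u.2 * u.2 = 1.
Proof. by move=> u1; rewrite -[LHS]/(dot u u) -enorm_sq u1 expr1n. Qed.

Lemma normr_dot_le u v : `|dot u v| <= enorm u * enorm v.
Proof.
rewrite -sqrtr_sqr -sqrtrM ?dot_ge0// ler_wsqrtr//.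
rewrite -subr_ge0 (_ : _ - _ = (u.1 * v.2 - u.2 * v.1) ^+ 2) ?sqr_ge0//.
by rewrite /dot; ring.
Qed.

Lemma normr_dot_unit u v : enorm v = 1 -> `|dot u v| <= enorm u.
Proof. by move=> v1; rewrite -[leRHS]mulr1 -v1 normr_dot_le. Qed.

Lemma enorm_perp u : enorm (perp u) = enorm u.
Proof. by congr Num.sqrt; rewrite /dot /perp /=; ring. Qed.

Lemma enorm_triangle u v w : enorm (vsub u w) <= enorm (vsub u v) + enorm (vsub v w).
Proof.
apply: enorm_le; first by rewrite addr_ge0 ?enorm_ge0.
have := le_trans (ler_norm _) (normr_dot_le (vsub u v) (vsub v w)).
rewrite sqrrD !enorm_sq /dot /vsub /= mulr2n; lra.
Qed.

End euclid.

Section taylor.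
Variable R : realType.

Lemma continuous_segment_bounded (h : R -> R) (r : R) : continuous h ->
  exists M : R, 0 <= M /\ forall t, `|t| <= r -> `|h t| <= M.
Proof.
move=> ch; have [r0|r0] := leP 0 r; last first.
  by exists 0; split => // t tr; move: (le_lt_trans tr r0); rewrite normr_lt0.
have nrr : - r <= r by lra.
have ch' : {within `[- r, r], continuous (fun t => `|h t|)}.
  apply: continuous_subspaceT => t.
  by apply: continuous_comp; [exact: ch|exact: norm_continuous].
have [c _ cmax] := EVT_max nrr ch'.
exists `|h c|; split => // t tr; apply: cmax.
by rewrite in_itv /= -ler_norml.
Qed.

(** The order of [a] and [b] is left open, and the last clause keeps [c] in every centred segment
    containing both, so that bounds valid for [|t| <= r] apply at [c]. *)
Lemma mean_value (phi dphi : R -> R) (a b : R) :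
  (forall t : R, is_derive t 1 phi (dphi t)) ->
  exists c, phi b - phi a = dphi c * (b - a) /\ `|c - a| <= `|b - a| /\
    (forall r, `|a| <= r -> `|b| <= r -> `|c| <= r).
Proof.
move=> dphiP.
have cphi : continuous phi.
  by move=> t; apply: differentiable_continuous; apply/derivable1_diffP.
have ccphi A : {within A, continuous phi} by exact: continuous_subspaceT.
have [ab|ba] := leP a b.
  have [c cab E] := MVT_segment ab (fun t _ => dphiP t) (ccphi _).
  move: cab; rewrite in_itv /= => /andP[ac cb]; exists c; split => //; split.
    by rewrite !ger0_norm; lra.
  by move=> r /ler_normlP[? ?] /ler_normlP[? ?]; apply/ler_normlP; split; lra.
have [c cab E] := MVT_segment (ltW ba) (fun t _ => dphiP t) (ccphi _).
move: cab; rewrite in_itv /= => /andP[ac cb]; exists c; split; first by lra.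
split; first by rewrite !ler0_norm; lra.
by move=> r /ler_normlP[? ?] /ler_normlP[? ?]; apply/ler_normlP; split; lra.
Qed.

(** One integration step through the mean value theorem: the exponent rises by one and [K] is not
    divided, so the Taylor remainders below carry no factorials. *)
Lemma derivative_bound_pow (phi dphi : R -> R) (r K a b : R) (k : nat) :
  (forall t : R, is_derive t 1 phi (dphi t)) -> phi a = 0 -> 0 <= K ->
  `|a| <= r -> `|b| <= r ->
  (forall t, `|t| <= r -> `|dphi t| <= K * `|t - a| ^+ k) ->
  `|phi b| <= K * `|b - a| ^+ k.+1.
Proof.
move=> dphiP phia K0 ar br Hd; have [c [E [ca cr]]] := mean_value a b dphiP.
rewrite phia subr0 in E; rewrite E normrM exprSr mulrA.
apply: ler_wpM2r => //; apply: le_trans (Hd c (cr r ar br)) _.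
by apply: ler_wpM2l => //; apply: lerXn2r; rewrite ?nnegrE.
Qed.

Lemma Ck_is_derive (k i : nat) (g : R -> R) (t : R) : Ck k g -> (i < k)%N ->
  is_derive t 1 (derive1n i g) (derive1n i.+1 g t).
Proof.
move=> [dg _] ik; apply: DeriveDef; first exact: dg.
by rewrite derive1nS derive1E.
Qed.

Lemma taylor_bounds (g g1 g2 g3 : R -> R) (r M2 M3 a b : R) :
  (forall t : R, is_derive t 1 g (g1 t)) ->
  (forall t : R, is_derive t 1 g1 (g2 t)) ->
  (forall t : R, is_derive t 1 g2 (g3 t)) ->
  0 <= M2 -> (forall t, `|t| <= r -> `|g2 t| <= M2) ->
  0 <= M3 -> (forall t, `|t| <= r -> `|g3 t| <= M3) ->
  `|a| <= r -> `|b| <= r ->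
  `|g b - g a - g1 a * (b - a)| <= M2 * `|b - a| ^+ 2 /\
  `|g b - g a - g1 a * (b - a) - g2 a / 2 * (b - a) ^+ 2| <= M3 * `|b - a| ^+ 3.
Proof.
move=> D0 D1 D2 M20 M2b M30 M3b ar br.
split.
- pose p0 t := g t - g a - g1 a * (t - a); pose p1 t := g1 t - g1 a.
  apply: (@derivative_bound_pow p0 p1 r) => //.
  - by move=> t; rewrite /p0 /p1; apply: is_derive_eq; rewrite /GRing.scale /=; ring.
  - by rewrite /p0; ring.
  move=> t tr; apply: (@derivative_bound_pow p1 g2 r) => //.
  - by move=> t'; rewrite /p1; apply: is_derive_eq; rewrite /GRing.scale /=; ring.
  - by rewrite /p1; ring.
  - by move=> t' tr'; rewrite expr0 mulr1; exact: M2b.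
- pose p0 t := g t - g a - g1 a * (t - a) - g2 a / 2 * (t - a) ^+ 2.
  pose p1 t := g1 t - g1 a - g2 a * (t - a); pose p2 t := g2 t - g2 a.
  apply: (@derivative_bound_pow p0 p1 r) => //.
  - by move=> t; rewrite /p0 /p1; apply: is_derive_eq; rewrite /GRing.scale /=; field.
  - by rewrite /p0; ring.
  move=> t tr; apply: (@derivative_bound_pow p1 p2 r) => //.
  - by move=> t'; rewrite /p1 /p2; apply: is_derive_eq; rewrite /GRing.scale /=; ring.
  - by rewrite /p1; ring.
  move=> t' tr'; apply: (@derivative_bound_pow p2 g3 r) => //.
  - by move=> t''; rewrite /p2; apply: is_derive_eq; rewrite /GRing.scale /=; ring.
  - by rewrite /p2; ring.
  - by move=> t'' tr''; rewrite expr0 mulr1; exact: M3b.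
Qed.

(** The expansion point [a] is arbitrary, because one chart has to serve all boundary points near
    its centre with a single [M]. *)
Lemma taylor_C3 (g : R -> R) (r : R) : Ck 3 g ->
  exists M : R, 0 <= M /\ forall a b, `|a| <= r -> `|b| <= r ->
   [/\ `|derive1n 1 g a| <= M, `|derive1n 2 g a| <= M,
     `|g b - g a - derive1n 1 g a * (b - a)| <= M * `|b - a| ^+ 2 &
     `|g b - g a - derive1n 1 g a * (b - a) - derive1n 2 g a / 2 * (b - a) ^+ 2|
       <= M * `|b - a| ^+ 3].
Proof.
move=> Cg; have [dg c3] := Cg.
have cd i : (i < 3)%N -> continuous (derive1n i g).
  by move=> i3 t; apply: differentiable_continuous; apply/derivable1_diffP; exact: dg.
have [M1 [M10 M1b]] := continuous_segment_bounded r (cd 1%N isT).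
have [M2 [M20 M2b]] := continuous_segment_bounded r (cd 2%N isT).
have [M3 [M30 M3b]] := continuous_segment_bounded r c3.
exists (M1 + M2 + M3); split; first by lra.
move=> a b ar br.
have D0 (t : R) : is_derive t 1 g (derive1n 1 g t) := @Ck_is_derive 3 0 g t Cg isT.
have D1 (t : R) : is_derive t 1 (derive1n 1 g) (derive1n 2 g t) := @Ck_is_derive 3 1 g t Cg isT.
have D2 (t : R) : is_derive t 1 (derive1n 2 g) (derive1n 3 g t) := @Ck_is_derive 3 2 g t Cg isT.
set g1 := derive1n 1 g in D0 D1 M1b *; set g2 := derive1n 2 g in D1 D2 M2b *.
have [lin quad] := taylor_bounds D0 D1 D2 M20 M2b M30 M3b ar br.
have b2 : 0 <= `|b - a| ^+ 2 by exact: exprn_ge0.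
have b3 : 0 <= `|b - a| ^+ 3 by exact: exprn_ge0.
split.
- by apply: le_trans (M1b a ar) _; lra.
- by apply: le_trans (M2b a ar) _; lra.
- by apply: le_trans lin _; apply: ler_wpM2r => //; lra.
- by apply: le_trans quad _; apply: ler_wpM2r => //; lra.
Qed.

End taylor.

(** * Uniform parabolic description of the domain near its boundary *)

(** A single [C] bounds the curvature coefficient, the cubic error and the inverse radius. The
    property is therefore monotone in [C], which is what the compactness argument needs. *)
Definition tube {R : realType} (O : set (pt R)) (C : R) (b e : pt R) : Prop :=
  exists kap : R, `|kap| <= C /\ forall y, enorm (vsub y b) <= C^-1 ->
    (O y -> dot (vsub y b) e - kap * dot (vsub y b) (perp e) ^+ 2
              <= C * enorm (vsub y b) ^+ 3) /\
    (~ O y -> - (C * enorm (vsub y b) ^+ 3)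
              <= dot (vsub y b) e - kap * dot (vsub y b) (perp e) ^+ 2).

Section tube_lemma.
Variable R : realType.

Lemma tube_le (O : set (pt R)) (C C' : R) (b e : pt R) :
  0 < C -> C <= C' -> tube O C b e -> tube O C' b e.
Proof.
move=> C0 CC' [kap [kC H]]; exists kap; split; first exact: le_trans CC'.
move=> y yb; have yC : enorm (vsub y b) <= C^-1.
  by apply: le_trans yb _; rewrite lef_pV2// posrE; exact: lt_le_trans CC'.
have le3 : C * enorm (vsub y b) ^+ 3 <= C' * enorm (vsub y b) ^+ 3.
  by apply: ler_wpM2r => //; apply: exprn_ge0; exact: enorm_ge0.
by have [Hin Hout] := H y yC; split => [/Hin|/Hout]; lra.
Qed.

Lemma exists_small (t K c : R) : 0 < t -> 0 < K -> 0 < c ->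
  exists tau, [/\ 0 < tau, tau < t & tau * K < c].
Proof.
move=> t0 K0 c0; exists (Num.min (t / 2) (c / K / 2)); split.
- by rewrite lt_min !divr_gt0.
- by rewrite gt_min; apply/orP; left; lra.
- have cK : c / K * K = c by rewrite divfK// gt_eqF.
  have : Num.min (t / 2) (c / K / 2) * K <= (c / K / 2) * K.
    by rewrite ler_pM2r// ge_min lexx orbT.
  lra.
Qed.

(** As [tau] tends to 0 the constant term decides the sign; once it vanishes, dividing by [tau]
    leaves the linear term. *)
Lemma quadratic_neg_coef (A L M t : R) : 0 < t -> 0 <= M ->
  (forall tau, 0 < tau -> tau < t -> A + tau * L - M * tau ^+ 2 < 0) ->
  A <= 0 /\ (A = 0 -> L <= 0).
Proof.
move=> t0 M0 H; split.
  rewrite leNgt; apply/negP => A0; have L0 := normr_ge0 L.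
  have [tau [tau0 taut tauA]] : exists tau, [/\ 0 < tau, tau < Num.min t 1 &
      tau * (`|L| + M + 1) < A] by apply: exists_small => //; [rewrite lt_min t0 ltr01|lra].
  move: taut; rewrite lt_min => /andP[taut tau1].
  have := H tau tau0 taut; have /ler_normlP[? ?] := lexx `|L|.
  have : M * tau ^+ 2 <= M * tau.
    by apply: ler_wpM2l => //; rewrite expr2 ler_piMl// ltW.
  have : - (tau * `|L|) <= tau * L by rewrite -mulrN; apply: ler_wpM2l; lra.
  nra.
move=> A0; rewrite leNgt; apply/negP => L0.
have M1 : 0 < M + 1 by lra.
have [tau [tau0 taut tauL]] := exists_small t0 M1 L0.
have := H tau tau0 taut; nra.
Qed.

Lemma flat_le (h : R -> R) (eps : R) : Ck 1 h -> h 0 = 0 -> derive1 h 0 = 0 ->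
  0 < eps -> exists t, 0 < t /\ forall u, `|u| < t -> `|h u| <= eps * `|u|.
Proof.
move=> Ch h0 dh0 eps0; have [_ cdh] := Ch.
have /cvgrPdist_lt /(_ eps eps0) : derive1n 1 h u @[u --> 0] --> derive1n 1 h 0 := cdh 0.
rewrite derive1n1 dh0 => /nbhs_ballP[t /= t0 Ht]; exists t; split => // u ut.
have Dh (x : R) : is_derive x 1 h (derive1 h x) := @Ck_is_derive R 1 0 h x Ch isT.
have [c [E [c0 _]]] := mean_value 0 u Dh.
rewrite h0 !subr0 in E c0; rewrite E normrM; apply: ler_wpM2r => //.
have := Ht c; rewrite /ball /= sub0r normrN => /(_ (le_lt_trans c0 ut)).
by rewrite sub0r normrN => /ltW.
Qed.

(** With both signs [sg], the hypothesis bounds the tangential component of [N] by [eps] times the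
    normal one, for every small [eps]. So the tangential component is 0, the normal one is
    nonnegative, and the length of [N] determines it. *)
Lemma gradient_parallel (nv N : pt R) (G : R) : enorm nv = 1 ->
  dot N N = 1 + G ^+ 2 ->
  (forall eps sg, 0 < eps -> eps <= 1 -> sg ^+ 2 = 1 ->
     sg * dot (perp nv) N - eps * dot nv N <= 0) ->
  exists w, [/\ 1 <= w, w ^+ 2 = 1 + G ^+ 2, N.1 = w * nv.1 & N.2 = w * nv.2].
Proof.
move=> nv1 NN H; have nn := dot_unit nv1.
set beta := dot (perp nv) N in H; set alpha := dot nv N in H.
have bound eps : 0 < eps -> eps <= 1 -> `|beta| <= eps * alpha.
  move=> e0 e1; apply/ler_normlP; split.
    by have := H eps (-1) e0 e1 ltac:(by rewrite sqrrN expr1n); lra.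
  by have := H eps 1 e0 e1 (expr1n _ _); lra.
have alpha0 : 0 <= alpha by have := bound 1 ltr01 (lexx _); have := normr_ge0 beta; lra.
have beta0 : beta = 0.
  apply/eqP; rewrite -normr_le0 leNgt; apply/negP => b0.
  have a1 : 0 < alpha + 1 by lra.
  have [eps [e0 e1 eb]] := exists_small ltr01 a1 b0.
  have := bound eps e0 (ltW e1); nra.
have N1 : N.1 = alpha * nv.1.
  transitivity (alpha * nv.1 + beta * (perp nv).1); last by rewrite beta0; ring.
  transitivity ((nv.1 * nv.1 + nv.2 * nv.2) * N.1); first by rewrite nn mul1r.
  by rewrite /alpha /beta /dot /perp /=; ring.
have N2 : N.2 = alpha * nv.2.
  transitivity (alpha * nv.2 + beta * (perp nv).2); last by rewrite beta0; ring.
  transitivity ((nv.1 * nv.1 + nv.2 * nv.2) * N.2); first by rewrite nn mul1r.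
  by rewrite /alpha /beta /dot /perp /=; ring.
have a2 : alpha ^+ 2 = 1 + G ^+ 2.
  rewrite -NN {1}/dot N1 N2; transitivity (alpha ^+ 2 * (nv.1 * nv.1 + nv.2 * nv.2)).
    by rewrite nn mulr1.
  by ring.
exists alpha; split => //.
have G2 := sqr_ge0 G; nra.
Qed.

(** [X] stands for n - kap a^2, [T] for the quadratic terms that still contain n, and [Rm] for the
    Taylor remainder. Since [K * rho <= 1 / 2], the share of [X] in the bound on [T] is absorbed on
    the left. *)
Lemma curved_coordinate_le (M rho w X T Rm : R) :
  let K := M * (M ^+ 2 + 2 * M) in
  0 <= M -> 0 <= rho -> K * rho <= 1 / 2 -> 1 <= w -> w * X <= w * T + Rm ->
  T <= K * rho * (`|X| + M * rho ^+ 2) -> Rm <= M * rho ^+ 3 ->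
  X <= 2 * (K * M + M) * rho ^+ 3.
Proof.
move=> K M0 rho0 Krho w1 wX TK RmM.
have K0 : 0 <= K by rewrite /K; do 2?apply: mulr_ge0 => //; apply: addr_ge0; nra.
have rho3 : 0 <= rho ^+ 3 by exact: exprn_ge0.
have KM0 : 0 <= (K * M + M) * rho ^+ 3 by apply: mulr_ge0 => //; nra.
have [X0|X0] := leP X 0; first by lra.
move: TK; rewrite gtr0_norm// => TK.
have Rm' : Rm <= w * (M * rho ^+ 3).
  apply: le_trans RmM _; rewrite ler_peMl//; exact: mulr_ge0.
have : w * X <= w * (T + M * rho ^+ 3) by rewrite mulrDr; lra.
rewrite ler_pM2l; last by lra.
have : K * rho * X <= 1 / 2 * X by apply: ler_wpM2r; lra.
have -> : 2 * (K * M + M) * rho ^+ 3 = 2 * (K * rho * (M * rho ^+ 2) + M * rho ^+ 3) by ring.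
move: TK; rewrite mulrDr; lra.
Qed.

Lemma curved_coordinate_sides (M rho w X T Rm : R) (P : Prop) :
  let K := M * (M ^+ 2 + 2 * M) in
  0 <= M -> 0 <= rho -> K * rho <= 1 / 2 -> 1 <= w ->
  `|T| <= K * rho * (`|X| + M * rho ^+ 2) -> `|Rm| <= M * rho ^+ 3 ->
  (P <-> w * X < w * T + Rm) ->
  (P -> X <= 2 * (K * M + M) * rho ^+ 3) /\
  (~ P -> - (2 * (K * M + M) * rho ^+ 3) <= X).
Proof.
move=> K M0 rho0 Krho w1 /ler_normlP[TK1 TK2] /ler_normlP[Rm1 Rm2] PE.
split=> [/PE /ltW|nP]; first by move/curved_coordinate_le; apply.
(* The lower side is the upper one for [- X], [- T], [- Rm]. *)
have wX : w * - X <= w * - T + - Rm.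
  have : w * T + Rm <= w * X by rewrite leNgt; apply/negP => /PE.
  by rewrite !mulrN; lra.
rewrite lerNl; apply: (curved_coordinate_le M0 rho0 Krho w1 wX) => //.
by rewrite normrN.
Qed.

End tube_lemma.

(** * Normal and curvature read off a nearby chart *)

Section charts.
Variable R : realType.

(** The graph is flat at [b], so after a tangential step [tau] it has moved by at most
    [eps / 2 * tau], less than the inward displacement [eps * tau]. The point [b] itself lies on the
    graph, and the subgraph is strict. *)
Lemma normal_subgraph_interior (O : set (pt R)) (b nv : pt R) :
  outward_unit_normal O b nv ->
  ~ O b /\ forall eps sg, 0 < eps -> eps <= 1 -> sg ^+ 2 = 1 ->
    exists t, 0 < t /\ forall tau, 0 < tau -> tau < t ->
      O (b.1 + tau * (sg * (perp nv).1 - eps * nv.1),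
         b.2 + tau * (sg * (perp nv).2 - eps * nv.2)).
Proof.
case=> _ [nv1 [r [h [r0 [h0 [Ch [dh0 HO]]]]]]].
have nn := dot_unit nv1.
have bb : vsub b b = (0, 0) by rewrite /vsub !subrr.
have dot0 v : dot ((0, 0) : pt R) v = 0 by rewrite /dot /= !mul0r addr0.
split.
  move=> Ob; have : enorm (vsub b b) < r by rewrite bb /enorm dot0 sqrtr0.
  by move/HO => [/(_ Ob)]; rewrite bb !dot0 h0 ltxx.
move=> eps sg e0 e1 sg2.
have sg1 : `|sg| = 1 by apply/eqP; rewrite -sqrp_eq1// -normrX sg2 normr1.
have e2 : 0 < eps / 2 by lra.
have [t [t0 Ht]] := flat_le Ch h0 dh0 e2.
exists (Num.min t (r / 2)); split; first by rewrite lt_min t0; lra.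
move=> tau tau0; rewrite lt_min => /andP[taut taur].
set y := (_, _).
have yn : dot (vsub y b) nv = - (eps * tau).
  transitivity (- (eps * tau) * (nv.1 * nv.1 + nv.2 * nv.2)); last by rewrite nn mulr1.
  by rewrite /dot /vsub /perp /=; ring.
have yp : dot (vsub y b) (perp nv) = sg * tau.
  transitivity (sg * tau * (nv.1 * nv.1 + nv.2 * nv.2)); last by rewrite nn mulr1.
  by rewrite /dot /vsub /perp /=; ring.
apply/HO.
  apply: (@le_lt_trans _ _ (2 * tau)); last by lra.
  apply: enorm_le; first by lra.
  have -> : dot (vsub y b) (vsub y b) =
     tau ^+ 2 * (sg ^+ 2 + eps ^+ 2) * (nv.1 * nv.1 + nv.2 * nv.2).
    by rewrite /dot /vsub /perp /=; ring.
  rewrite nn mulr1 sg2 exprMn [leRHS]mulrC; apply: ler_wpM2l; first exact: sqr_ge0.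
  nra.
rewrite yn yp; have := Ht (sg * tau).
rewrite normrM sg1 mul1r gtr0_norm// => /(_ taut) /ler_normlP[? ?]; nra.
Qed.

(* The gradient of [v - g u] at [b] has nonpositive product with every inward
   direction [sg * perp nv - eps * nv]; letting [eps] tend to 0 shows that it is
   a positive multiple of [nv]. *)
Lemma chart_normal (O : set (pt R)) (b0 e b nv : pt R) (r M : R) (g : R -> R) :
  enorm e = 1 -> enorm nv = 1 -> 0 <= M ->
  (forall u v, `|u| <= r -> `|v| <= r ->
     `|g v - g u - derive1n 1 g u * (v - u)| <= M * `|v - u| ^+ 2) ->
  (forall y, enorm (vsub y b0) < r ->
     (O y <-> dot (vsub y b0) e < g (dot (vsub y b0) (perp e)))) ->
  enorm (vsub b b0) < r / 2 -> outward_unit_normal O b nv ->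
  let G := derive1n 1 g (dot (vsub b b0) (perp e)) in
  dot (vsub b b0) e = g (dot (vsub b b0) (perp e)) /\
  exists w, [/\ 1 <= w, w ^+ 2 = 1 + G ^+ 2,
    e.1 - G * (perp e).1 = w * nv.1 & e.2 - G * (perp e).2 = w * nv.2].
Proof.
move=> e1 nv1 M0 Hg HO br onv G.
have [nOb Hin] := normal_subgraph_interior onv.
have ee := dot_unit e1; have nn := dot_unit nv1.
set v0 := dot (vsub b b0) e; set t0 := dot (vsub b b0) (perp e) in G *.
pose N : pt R := (e.1 - G * (perp e).1, e.2 - G * (perp e).2).
have r0 : 0 < r by have := enorm_ge0 (vsub b b0); lra.
have p1 : enorm (perp e) = 1 by rewrite enorm_perp.
have t0r : `|t0| <= r by have := normr_dot_unit (vsub b b0) p1; rewrite -/t0; lra.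
(* The points [y] given by [Hin] lie within [2 * tau] of [b], so the Taylor error is at most
   [4 * M * tau ^+ 2]; the linear coefficient is the derivative of v - g u in the chosen
   direction. *)
have key eps sg : 0 < eps -> eps <= 1 -> sg ^+ 2 = 1 ->
    v0 - g t0 <= 0 /\
    (v0 - g t0 = 0 -> sg * dot (perp nv) N - eps * dot nv N <= 0).
  move=> eps0 eps1 sg2; have [t [tp Ht]] := Hin eps sg eps0 eps1 sg2.
  apply: (@quadratic_neg_coef _ _ _ (4 * M) (Num.min t (r / 4))).
  - by rewrite lt_min tp; lra.
  - by lra.
  move=> tau tau0; rewrite lt_min => /andP[taut taur].
  have := Ht tau tau0 taut; set y := (_, _) => Oy.
  have yb : enorm (vsub y b) <= 2 * tau.
    apply: enorm_le; first by lra.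
    have -> : dot (vsub y b) (vsub y b) =
       tau ^+ 2 * (sg ^+ 2 + eps ^+ 2) * (nv.1 * nv.1 + nv.2 * nv.2).
      by rewrite /dot /vsub /perp /=; ring.
    rewrite nn mulr1 sg2 exprMn [leRHS]mulrC; apply: ler_wpM2l; first exact: sqr_ge0.
    nra.
  have yb0 : enorm (vsub y b0) < r by have := enorm_triangle y b b0; lra.
  have ue : dot (vsub y b0) e = v0 + dot (vsub y b) e by rewrite /v0 /dot /vsub /=; ring.
  have up : dot (vsub y b0) (perp e) = t0 + dot (vsub y b) (perp e).
    by rewrite /t0 /dot /vsub /=; ring.
  have upr : `|t0 + dot (vsub y b) (perp e)| <= r.
    by rewrite -up; have := normr_dot_unit (vsub y b0) p1; lra.
  have := Hg t0 _ t0r upr; rewrite [t0 + _ - t0]addrAC subrr add0r -/G.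
  have := normr_dot_unit (vsub y b) p1; set th := dot (vsub y b) (perp e) => thle.
  have th2 : `|th| ^+ 2 <= 4 * tau ^+ 2.
    have := normr_ge0 th; nra.
  have : M * `|th| ^+ 2 <= M * (4 * tau ^+ 2) by apply: ler_wpM2l.
  move=> Mth /ler_normlP[gl gr]; have := (HO y yb0).1 Oy; rewrite ue up -/th.
  have -> : tau * (sg * dot (perp nv) N - eps * dot nv N) = dot (vsub y b) e - G * th.
    by rewrite /th /N /dot /vsub /perp /=; ring.
  lra.
(* Points of [O] tending to [b] give one inequality; if the other failed, the chart would put [b] in
   [O]. *)
have v0g : v0 - g t0 = 0.
  apply/le_anti/andP; split; first by have [] := key 1 1 ltr01 (lexx _) (expr1n _ _).
  rewrite leNgt; apply/negP => v0g; apply: nOb; apply/HO; first by lra.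
  by rewrite -/v0 -/t0; lra.
split; first by lra.
have NN : dot N N = 1 + G ^+ 2.
  transitivity ((1 + G ^+ 2) * (e.1 * e.1 + e.2 * e.2)); last by rewrite ee mulr1.
  by rewrite /N /dot /perp /=; ring.
apply: (gradient_parallel nv1 NN) => eps sg eps0 eps1 sg2.
by have [_ /(_ v0g)] := key eps sg eps0 eps1 sg2.
Qed.

Lemma chart_tube (O : set (pt R)) (b0 e : pt R) : graph_chart 3 O b0 e ->
  exists rho C, 0 < rho /\ 0 < C /\ forall b nv, enorm (vsub b b0) < rho ->
    outward_unit_normal O b nv -> tube O C b nv.
Proof.
case=> e1 [r [g [r0 [g0 [Cg HO]]]]].
have [M [M0 HM]] := taylor_C3 r Cg.
pose K := M * (M ^+ 2 + 2 * M).
have K0 : 0 <= K by rewrite /K; apply: mulr_ge0 => //; apply: addr_ge0; nra.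
have KM0 : 0 <= K * M by exact: mulr_ge0.
have r40 : 0 < 4 / r by rewrite divr_gt0.
(* The summands ensure in turn [C^-1 <= r / 4], [K * rho <= 1 / 2], the cubic error bound and
   [|kap| <= C]; the final 1 gives positivity. *)
pose C := 4 / r + 2 * K + 2 * (K * M + M) + M + 1.
have C0 : 0 < C by rewrite /C; lra.
exists (r / 2), C; split; first by lra.
split => // b nv br onv.
have nv1 : enorm nv = 1 by case: onv => _ [].
have [v0g [w [w1 w2 N1 N2]]] := chart_normal e1 nv1 M0
  (fun u v ur vr => let: And4 _ _ H _ := HM u v ur vr in H) HO br onv.
have p1 : enorm (perp e) = 1 by rewrite enorm_perp.
have ee := dot_unit e1; have nn := dot_unit nv1.
set v0 := dot (vsub b b0) e in v0g; set t0 := dot (vsub b b0) (perp e) in v0g w2 N1 N2.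
set G := derive1n 1 g t0 in w2 N1 N2.
have t0r : `|t0| <= r by have := normr_dot_unit (vsub b b0) p1; rewrite -/t0; lra.
have [GM HM2 _ _] := HM t0 t0 t0r t0r; rewrite -/G in GM.
set g2 := derive1n 2 g t0 in HM2.
have w0 : w != 0 by rewrite gt_eqF//; lra.
(* Since [w ^+ 2 = 1 + G ^+ 2], this is half the signed curvature of the graph at [t0]. *)
pose kap := g2 / (2 * w ^+ 3).
have w3 : 1 <= w ^+ 3 by exact: exprn_ege1.
have kapM : `|kap| <= M.
  rewrite /kap normrM normfV (ger0_norm (_ : 0 <= 2 * w ^+ 3)); last by lra.
  rewrite ler_pdivrMr; last by lra.
  by apply: le_trans HM2 _; rewrite ler_peMr//; lra.
exists kap; split; first by rewrite /C; lra.
move=> y yb.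
have yr4 : enorm (vsub y b) <= r / 4.
  apply: le_trans yb _; rewrite -(invrK (r / 4)) lef_pV2 ?posrE ?invr_gt0//; last by lra.
  by rewrite invf_div /C; lra.
set rho := enorm (vsub y b) in yb yr4 *.
have rho0 : 0 <= rho by exact: enorm_ge0.
have Krho : K * rho <= 1 / 2.
  have : C * rho <= 1 by rewrite -ler_pdivlMl ?mulr1.
  have : 2 * K * rho <= C * rho by apply: ler_wpM2r => //; rewrite /C; lra.
  lra.
have yb0 : enorm (vsub y b0) < r by have := enorm_triangle y b b0; rewrite -/rho; lra.
set n := dot (vsub y b) nv; set a := dot (vsub y b) (perp nv).
set h := dot (vsub y b) (perp e).
have nrho : `|n| <= rho by exact: normr_dot_unit.
have arho : `|a| <= rho by apply: normr_dot_unit; rewrite enorm_perp.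
have hrho : `|h| <= rho by exact: normr_dot_unit.
have ue : dot (vsub y b0) e = v0 + (w * n + G * h).
  transitivity (v0 + dot (vsub y b) (e.1 - G * (perp e).1, e.2 - G * (perp e).2) + G * h).
    by rewrite /v0 /h /dot /vsub /=; ring.
  by rewrite N1 N2 /n /dot /=; ring.
have up : dot (vsub y b0) (perp e) = t0 + h by rewrite /t0 /h /dot /vsub /=; ring.
(* An exact relation: the two orthonormal frames differ by a rotation with cosine 1/w and sine of
   size |G|/w. *)
have wh : w * h = a - G * n.
  have aw : w * a = (1 + G ^+ 2) * h + G * w * n.
    transitivity (dot (vsub y b) (perp (w * nv.1, w * nv.2))).
      by rewrite /a /dot /perp /=; ring.
    rewrite -N1 -N2; transitivity (dot (vsub y b)
       ((1 + G ^+ 2) * (perp e).1 + G * (e.1 - G * (perp e).1),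
        (1 + G ^+ 2) * (perp e).2 + G * (e.2 - G * (perp e).2))).
      by rewrite /dot /perp /=; ring.
    by rewrite N1 N2 /h /n /dot /=; ring.
  apply: (mulfI w0); rewrite mulrBr aw -w2; ring.
have hE : h = (a - G * n) / w by rewrite -wh [w * h]mulrC mulfK.
have upr : `|t0 + h| <= r.
  by rewrite -up; have := normr_dot_unit (vsub y b0) p1; lra.
have [_ _ _] := HM t0 (t0 + h) t0r upr.
rewrite [t0 + _ - t0]addrAC subrr add0r -/G -/g2.
set Rm := _ - _ - _ - _ => RmM.
have gE : g (t0 + h) = g t0 + G * h + g2 / 2 * h ^+ 2 + Rm by rewrite /Rm; ring.
have RmM' : `|Rm| <= M * rho ^+ 3.
  apply: le_trans RmM _; apply: ler_wpM2l => //; apply: lerXn2r; rewrite ?nnegrE//.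
have kapE : g2 / 2 * h ^+ 2 = w * (kap * (a - G * n) ^+ 2).
  by rewrite /kap hE; field.
pose X := n - kap * a ^+ 2.
(* What remains of [kap * (a - G * n) ^+ 2] after removing [kap * a ^+ 2]; every term has a factor
   [n]. *)
pose T := kap * (G ^+ 2 * n ^+ 2 - 2 * a * G * n).
have Xn : `|n| <= `|X| + M * rho ^+ 2.
  rewrite (_ : n = X + kap * a ^+ 2); last by rewrite /X; ring.
  apply: le_trans (ler_normD _ _) _; rewrite lerD2l normrM.
  by apply: ler_pM => //; rewrite normrX; apply: lerXn2r; rewrite ?nnegrE.
have TK : `|T| <= K * rho * (`|X| + M * rho ^+ 2).
  apply: (@le_trans _ _ (K * rho * `|n|)); last by apply: ler_wpM2l => //; exact: mulr_ge0.
  have -> : T = kap * ((G ^+ 2 * n - 2 * (a * G)) * n) by rewrite /T; ring.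
  have -> : K * rho * `|n| = M * ((M ^+ 2 * rho + 2 * (rho * M)) * `|n|).
    by rewrite /K; ring.
  rewrite [leLHS]normrM; apply: ler_pM => //; rewrite [leLHS]normrM.
  apply: ler_wpM2r => //; apply: le_trans (ler_normB _ _) _; apply: lerD.
    by rewrite normrM normrX; apply: ler_pM => //; apply: lerXn2r; rewrite ?nnegrE.
  rewrite !normrM (ger0_norm (_ : 0 <= 2))//; apply: ler_wpM2l => //.
  exact: ler_pM.
have C3 : 2 * (K * M + M) * rho ^+ 3 <= C * rho ^+ 3.
  by apply: ler_wpM2r; [exact: exprn_ge0|rewrite /C; lra].
have OyE : O y <-> w * X < w * T + Rm.
  have E : g t0 + G * h + w * (kap * (a - G * n) ^+ 2) + Rm -
      (g t0 + (w * n + G * h)) = w * T + Rm - w * X by rewrite /X /T; ring.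
  have lt_sub (p q p' q' : R) : q - p = q' - p' -> (p < q) = (p' < q').
    by move=> pq; rewrite -subr_gt0 pq subr_gt0.
  by rewrite HO// ue up gE kapE v0g (lt_sub _ _ _ _ E).
have [Xle Xge] := curved_coordinate_sides M0 rho0 Krho w1 TK RmM' OyE.
split=> [/Xle H|/Xge H]; first exact: le_trans H C3.
by apply: le_trans H; rewrite lerN2.
Qed.

End charts.

(** * Uniformity by compactness of the boundary *)

Lemma compact_boundary (R : realType) (O : set (pt R)) (M : R) :
  (forall y, O y -> enorm y <= M) -> compact (boundary O).
Proof.
move=> OM; pose B : set (pt R) := `[- M, M]%classic `*` `[- M, M]%classic.
have cB : compact B by apply: compact_setX; exact: segment_compact.
have clB : closed B by apply: compact_closed => //; exact: norm_hausdorff.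
have OB : O `<=` B.
  move=> y /OM yM.
  have e1 : enorm ((1, 0) : pt R) = 1 by rewrite /enorm /dot /= mulr1 mulr0 addr0 sqrtr1.
  have e2 : enorm ((0, 1) : pt R) = 1 by rewrite /enorm /dot /= mulr1 mulr0 add0r sqrtr1.
  have := le_trans (normr_dot_unit y e1) yM; have := le_trans (normr_dot_unit y e2) yM.
  rewrite /dot /= !mulr1 !mulr0 addr0 add0r => y2 y1.
  by split; rewrite /= in_itv /= -ler_norml.
apply: (subclosed_compact _ cB).
  by apply: closedI; [exact: closed_closure|apply: open_closedC; exact: open_interior].
by move=> y [yc _]; rewrite (closure_id B).1//; exact: closure_subset yc.
Qed.

Lemma enorm_nbhs (R : realType) (b : pt R) (rho : R) : 0 < rho ->
  nbhs b [set y | enorm (vsub y b) < rho].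
Proof.
move=> rho0; apply/nbhs_ballP; exists (rho / 2) => /=; first by lra.
move=> y [/=]; rewrite /ball /= => /ltr_normlP[? ?] /ltr_normlP[? ?].
apply: (@le_lt_trans _ _ (3 / 4 * rho)); last by lra.
by apply: enorm_le; rewrite /dot /vsub /=; nra.
Qed.

(** By [tube_le] a local constant may be enlarged freely, so the claim can be made along the filter
    of [C] tending to +oo. The near-covering form of compactness then yields a common [C] without an
    explicit maximum over a finite subcover. *)
Lemma uniform_tube (R : realType) (O : set (pt R)) : C3_bounded_domain O ->
  exists C, 0 < C /\ forall b nv, outward_unit_normal O b nv -> tube O C b nv.
Proof.
move=> [_ [_ [_ [[M OM] Och]]]].
have /compact_near_coveringP ncov := compact_boundary OM.
have : \forall C \near +oo, forall b, boundary O b ->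
    forall nv, outward_unit_normal O b nv -> tube O C b nv.
  apply: (ncov R (pinfty_nbhs R)
    (fun C b => forall nv, outward_unit_normal O b nv -> tube O C b nv)).
  move=> b /Och[e /chart_tube[rho [C [rho0 [C0 HC]]]]].
  exists ([set y | enorm (vsub y b) < rho], [set C' | C <= C']).
    by split => /=; [exact: enorm_nbhs|apply: nbhs_pinfty_ge; exact: num_real].
  by move=> [y C'] [/= yb CC'] nv onv; exact: tube_le C0 CC' (HC _ _ yb onv).
move=> nC; have [C [HC C0]] : exists C, (forall b, boundary O b ->
    forall nv, outward_unit_normal O b nv -> tube O C b nv) /\ 0 < C.
  have [C [? ?]] := filter_ex (filterI nC (nbhs_pinfty_gt (num_real (0 : R)))).
  by exists C.
by exists C; split => // b nv onv; apply: HC => //; case: onv.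
Qed.

(** * Invariance of planar Lebesgue measure under orthonormal frames *)

Notation mR R := (measurableTypeR R).
Notation mR2 R := (measurableTypeR R * measurableTypeR R)%type.

(** Balls of the max-norm are products of intervals, and an open set is the countable union of the
    rational ones it contains. *)
Lemma open_measurable_prod (R : realType) (O : set (R * R)) :
  open O -> measurable (O : set (mR2 R)).
Proof.
move=> oO.
pose F (q : rat * rat * rat) : set (R * R) := 
  let A := ball (ratr q.1.1 : R) (ratr q.2) `*` ball (ratr q.1.2 : R) (ratr q.2) in
  if `[< A `<=` O >] then A else set0.
have -> : O = \bigcup_q F q.
  apply/seteqP; split=> [[x1 x2] Ox|x [q _]]; last first.
    by rewrite /F; case: asboolP => // AO; exact: AO.
  have /nbhs_ballP[e /= e0 xeO] : nbhs (x1, x2) O by move: oO; rewrite openE; exact.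
  (* With the centre within [e / 4] of the point in each coordinate and a radius between [e / 4] and
     [e / 2], the square contains the point and stays inside its [e]-ball. *)
  have [q2 ] := @rat_in_itvoo R (e / 4) (e / 2) ltac:(lra).
  rewrite in_itv /= => /andP[q21 q22].
  have [p1 ] := @rat_in_itvoo R (x1 - e / 4) (x1 + e / 4) ltac:(lra).
  rewrite in_itv /= => /andP[p11 p12].
  have [p2 ] := @rat_in_itvoo R (x2 - e / 4) (x2 + e / 4) ltac:(lra).
  rewrite in_itv /= => /andP[p21 p22].
  exists ((p1, p2), q2) => //; rewrite /F /=; case: asboolP => [_|]; last first.
    case=> -[y1 y2] /= [] /=; rewrite /ball /= => /ltr_normlP[? ?] /ltr_normlP[? ?].
    by apply: xeO; split; rewrite /ball /=; apply/ltr_normlP; split; lra.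
  by split; rewrite /ball /=; apply/ltr_normlP; split; lra.
apply: countable_bigcupT_measurable; first exact: countableP.
move=> q; rewrite /F; case: asboolP => _; last exact: measurable0.
by apply: measurableX; apply: open_measurable; exact: ball_open.
Qed.

(** By uniqueness it suffices to compare both measures on half-open intervals. For negative [a] the
    preimage is half-open at the other end, with the same length. *)
Lemma lebesgue_measure_affine (R : realType) (a c : R) (A : set (mR R)) :
  a != 0 -> measurable A ->
  lebesgue_measure ((fun u : mR R => a * u + c : mR R) @^-1` A) =
  (`|a|^-1%:E * lebesgue_measure A)%E.
Proof.
move=> a0 mA.
pose phi : mR R -> mR R := fun u => a * u + c.
have mphi : measurable_fun setT phi.
  apply: measurable_funD => //; exact: mulrl_measurable.
have an0 : 0 < `|a| by rewrite normr_gt0.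
have -> : lebesgue_measure A =
    (`|a|%:E * pushforward (@lebesgue_measure R) phi A)%E.
  pose r : {nonneg R} := NngNum (normr_ge0 a).
  have -> : (`|a|%:E * pushforward (@lebesgue_measure R) phi A)%E =
    mscale r (pushforward (@lebesgue_measure R) phi) A by [].
  apply: lebesgue_measure_unique => //.
  move=> X [[u v] _ <-] /=.
  rewrite /mscale /= /pushforward.
  have aE : a * a^-1 = 1 by rewrite mulfV.
  have {aE} -> : phi @^-1` `]u, v] = if 0 < a then `](u - c) / a, (v - c) / a]%classic
      else `[(v - c) / a, (u - c) / a[%classic.
    apply/seteqP; case: ltP => a0'; split => w; rewrite /phi /= !in_itv /=.
    - by rewrite ltr_pdivrMr// ler_pdivlMr// => /andP[? ?]; apply/andP; split; lra.
    - by rewrite ltr_pdivrMr// ler_pdivlMr// => /andP[? ?]; apply/andP; split; lra.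
    - have a1 : a < 0 by rewrite lt_neqAle a0.
      by rewrite ltr_ndivlMr// ler_ndivrMr// => /andP[? ?]; apply/andP; split; lra.
    - have a1 : a < 0 by rewrite lt_neqAle a0.
      by rewrite ltr_ndivlMr// ler_ndivrMr// => /andP[? ?]; apply/andP; split; lra.
  case: ltP => a1.
    rewrite !lebesgue_measure_itv /= !lte_fin ltr_pM2r ?invr_gt0// ltrD2r.
    case: ifP => _; rewrite ?mule0//= -!EFinB -EFinM gtr0_norm//; congr EFin.
    by field; rewrite gt_eqF.
  have {a1}a1 : a < 0 by rewrite lt_neqAle a0.
  rewrite !lebesgue_measure_itv /= !lte_fin ltr_nM2r ?invr_lt0// ltrD2r.
  case: ifP => _; rewrite ?mule0//= -!EFinB -EFinM ltr0_norm//; congr EFin.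
  by field; rewrite lt_eqF.
rewrite /pushforward muleA -EFinM mulVf ?mul1e//.
by rewrite gt_eqF.
Qed.

(** Cavalieri: on each vertical section the map is affine with slope [a]. *)
Lemma leb2_shear (R : realType) (a b c : R) (A : set (mR2 R)) :
  a != 0 -> measurable A ->
  leb2 ((fun z : mR2 R => (z.1, b * z.1 + a * z.2 + c) : mR2 R) @^-1` A) =
  (`|a|^-1%:E * leb2 A)%E.
Proof.
move=> a0 mA; rewrite /leb2 /product_measure1 /=.
rewrite -ge0_integralZl//; last exact: measurable_fun_xsection.
apply: eq_integral => u _ /=.
rewrite -(@lebesgue_measure_affine _ a (b * u + c))//; last exact: measurable_xsection.
congr (lebesgue_measure _); apply/seteqP; split=> v; rewrite /xsection /= !inE /=.
  by rewrite addrCA addrA.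
by rewrite addrCA addrA.
Qed.

Lemma leb2_swap (R : realType) (A : set (mR2 R)) :
  measurable A -> leb2 ((fun z : mR2 R => (z.2, z.1) : mR2 R) @^-1` A) = leb2 A.
Proof.
move=> mA; pose sw : mR2 R -> mR2 R := fun z => (z.2, z.1).
have msw : measurable_fun setT sw.
  by apply: measurable_fun_pair; [exact: measurable_snd|exact: measurable_fst].
apply/esym; rewrite (_ : leb2 (_ @^-1` A) = pushforward (@leb2 R) sw A)//.
apply: product_measure_unique => // B C mB mC.
transitivity (leb2 (C `*` B)).
  rewrite [LHS]/(leb2 _); congr leb2; apply/seteqP; split => -[x y] [] //.
by rewrite /leb2 product_measure1E//= muleC.
Qed.

Lemma measurable_affine (R : realType) (a b c : R) :
  measurable_fun setT (fun z : mR2 R => a * z.1 + b * z.2 + c : mR R).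
Proof.
apply: measurable_funD => //; apply: measurable_funD => //.
  by apply: measurable_funM => //; exact: measurable_fst.
by apply: measurable_funM => //; exact: measurable_snd.
Qed.

Definition frame {R : realType} (x n : pt R) (z : mR2 R) : mR2 R :=
  (x.1 + z.1 * (perp n).1 + z.2 * n.1, x.2 + z.1 * (perp n).2 + z.2 * n.2).

Lemma measurable_frame (R : realType) (x n : pt R) :
  measurable_fun setT (frame x n).
Proof.
rewrite /frame; apply: measurable_fun_pair.
  rewrite (_ : (fun _ => _) = fun z : mR2 R => (perp n).1 * z.1 + n.1 * z.2 + x.1).
    exact: measurable_affine.
  by apply/funext => z; ring.
rewrite (_ : (fun _ => _) = fun z : mR2 R => (perp n).2 * z.1 + n.2 * z.2 + x.2).
  exact: measurable_affine.
by apply/funext => z; ring.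
Qed.

Lemma measurable_preimage (d d' : measure_display) (T : measurableType d)
  (U : measurableType d') (f : T -> U) (A : set U) :
  measurable_fun setT f -> measurable A -> measurable (f @^-1` A).
Proof. by move=> mf mA; rewrite -[X in measurable X]setTI; exact: mf. Qed.

(* For [n.1 != 0], [frame] is an LU product of two shears; otherwise
   [n.2 = 1 or -1] and it is a composition of axis scalings. *)
Lemma leb2_frame (R : realType) (x n : pt R) (A : set (mR2 R)) :
  enorm n = 1 -> measurable A -> leb2 (frame x n @^-1` A) = leb2 A.
Proof.
move=> n1 mA.
have nn : n.1 ^+ 2 + n.2 ^+ 2 = 1 by rewrite !expr2 dot_unit.
pose sw (z : mR2 R) : mR2 R := (z.2, z.1).
have msw : measurable_fun setT sw.
  by apply: measurable_fun_pair; [exact: measurable_snd|exact: measurable_fst].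
pose sh (a b c : R) (z : mR2 R) : mR2 R := (z.1, b * z.1 + a * z.2 + c).
have msh a b c : measurable_fun setT (sh a b c).
  apply: measurable_fun_pair; first exact: measurable_fst.
  exact: measurable_affine.
have [n10|n10] := eqVneq n.1 0.
  have n2 : n.2 != 0 by apply: contra_eq_neq nn => ->; rewrite n10; lra.
  have E z : frame x n z = sh n.2 0 x.2 (sw (sh (- n.2) 0 x.1 (sw z))).
    by rewrite /frame /sw /sh /perp /= n10; congr pair; ring.
  have -> : frame x n @^-1` A =
      sw @^-1` (sh (- n.2) 0 x.1 @^-1` (sw @^-1` (sh n.2 0 x.2 @^-1` A))).
    by rewrite /preimage; apply: eq_set => z; rewrite E.
  have m1 : measurable (sh n.2 0 x.2 @^-1` A) by exact: measurable_preimage.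
  have m2 : measurable (sw @^-1` (sh n.2 0 x.2 @^-1` A)) by exact: measurable_preimage.
  rewrite leb2_swap; last exact: measurable_preimage.
  rewrite leb2_shear ?oppr_eq0//.
  rewrite leb2_swap// leb2_shear// normrN muleA -EFinM -invfM -normrM.
  rewrite -expr2; move: nn; rewrite n10 expr0n add0r => ->.
  by rewrite normr1 invr1 mul1e.
(* The factor [n.1 ^+ 2 + n.2 ^+ 2] makes this an identity for any [n] with [n.1 != 0]. Once it is
   set to 1, the two shears scale by inverse amounts. *)
have E z : frame x n z = sh ((n.1 ^+ 2 + n.2 ^+ 2) / n.1) (n.2 / n.1)
    (x.2 - n.2 * x.1 / n.1) (sw (sh n.1 (- n.2) x.1 z)).
  by rewrite /frame /sw /sh /perp /=; congr pair; field.
have -> : frame x n @^-1` A =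
    sh n.1 (- n.2) x.1 @^-1` (sw @^-1`
     (sh ((n.1 ^+ 2 + n.2 ^+ 2) / n.1) (n.2 / n.1) (x.2 - n.2 * x.1 / n.1) @^-1` A)).
  by rewrite /preimage; apply: eq_set => z; rewrite E.
rewrite nn mul1r.
have m1 : measurable (sh n.1^-1 (n.2 / n.1) (x.2 - n.2 * x.1 / n.1) @^-1` A).
  exact: measurable_preimage.
rewrite leb2_shear//; last exact: measurable_preimage.
rewrite leb2_swap// leb2_shear ?invr_eq0// muleA -EFinM normfV invrK mulVf.
  by rewrite mul1e.
by rewrite normr_eq0.
Qed.

(** * Integral estimates *)

Lemma measurable_vsub (R : realType) (x : pt R) :
  measurable_fun setT (fun y : mR2 R => vsub y x : mR2 R).
Proof.
by apply: measurable_fun_pair; apply: measurable_funB => //;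
  (exact: measurable_fst || exact: measurable_snd).
Qed.

Lemma measurable_dot (R : realType) (u : pt R) :
  measurable_fun setT (fun z : mR2 R => dot z u : mR R).
Proof.
by apply: measurable_funD => //; apply: measurable_funM => //;
  (exact: measurable_fst || exact: measurable_snd).
Qed.

Lemma measurable_enorm (R : realType) :
  measurable_fun setT (fun z : mR2 R => enorm z : mR R).
Proof.
apply: (@measurableT_comp _ _ _ _ _ _ (@Num.sqrt R : mR R -> mR R) _
  (fun z : mR2 R => dot z z : mR R)).
  apply: continuous_measurable_fun; exact: sqrt_continuous.
by apply: measurable_funD => //; apply: measurable_funM => //;
  (exact: measurable_fst || exact: measurable_snd).
Qed.

Lemma measurable_Kern (R : realType) (delta : R) :
  measurable_fun setT (Kern delta : mR R -> mR R).
Proof.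
have -> : Kern delta = fun r => if (0 < r) && (r <= delta) then r `^ (-1) else 0.
  apply/funext => r; rewrite /Kern; case: ifPn => // /andP[r0 _].
  by rewrite powR_inv1// ltW.
have mp : measurable_fun setT (fun r : mR R => r `^ (-1) : mR R) := @measurable_powR R (-1).
apply: measurable_fun_ifT => //.
apply: measurable_and.
  by apply: measurable_fun_ltr.
by apply: measurable_fun_ler.
Qed.

Lemma measurable_ballE (R : realType) (x : pt R) (delta : R) :
  measurable (Defs.ballE x delta : set (mR2 R)).
Proof.
have -> : Defs.ballE x delta =
    ((fun z : mR2 R => enorm z : mR R) \o (fun y : mR2 R => vsub y x : mR2 R))
      @^-1` `]-oo, delta].
  by apply/seteqP; split => y; rewrite /Defs.ballE /= in_itv.
apply: measurable_preimage; last exact: measurable_itv.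
apply: measurableT_comp; [exact: measurable_enorm|exact: measurable_vsub].
Qed.

Lemma measurable_sublevel (R : realType) (f : mR2 R -> mR R) (c : R) :
  measurable_fun setT f -> measurable [set y | f y < c].
Proof.
move=> mf; have -> : [set y | f y < c] = f @^-1` `]-oo, c[.
  by apply/seteqP; split => y; rewrite /= in_itv.
by apply: measurable_preimage mf _; exact: measurable_itv.
Qed.

Lemma leb2_ballE_lty (R : realType) (x : pt R) (delta : R) :
  (leb2 (Defs.ballE x delta) < +oo)%E.
Proof.
pose I (c : R) : set (mR R) := `[c - delta, c + delta]%classic.
apply: (@le_lt_trans _ _ (leb2 (I x.1 `*` I x.2))).
  apply: le_measure; rewrite ?inE; [exact: measurable_ballE| |].
    by apply: measurableX; exact: measurable_itv.
  move=> y; rewrite /Defs.ballE /= => yx.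
  have le1 (u v : R) : `|u| <= Num.sqrt (u * u + v * v).
    rewrite -sqrtr_sqr ler_wsqrtr// expr2 lerDl -expr2 sqr_ge0//.
  have le2 (u v : R) : `|v| <= Num.sqrt (u * u + v * v) by rewrite addrC.
  have /ler_normlP[? ?] := le_trans (le1 (y.1 - x.1) (y.2 - x.2)) yx.
  have /ler_normlP[? ?] := le_trans (le2 (y.1 - x.1) (y.2 - x.2)) yx.
  by split; rewrite /I /= in_itv /=; apply/andP; split; lra.
rewrite /leb2 product_measure1E; [|exact: measurable_itv..].
have Ioo c : (lebesgue_measure (I c) < +oo)%E.
  by rewrite lebesgue_measure_itv /=; case: ifP => // _; exact: ltry.
apply: lte_mul_pinfty => //; last exact: Ioo.
by rewrite ge0_fin_numE; [exact: Ioo|exact: measure_ge0].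
Qed.

Lemma integrable_bounded d (T : measurableType d) (R : realType)
    (mu : {measure set T -> \bar R}) (f : T -> R) (c : R) (D : set T) :
  measurable_fun setT f -> (forall y, `|f y| <= c) ->
  measurable D -> (mu D < +oo)%E -> mu.-integrable D (EFin \o f).
Proof.
move=> mf fc mD Doo; apply: measurable_bounded_integrable => //.
  exact: measurable_funTS.
exists c; split; first exact: num_real.
by move=> M cM y _; exact: le_trans (fc y) (ltW cM).
Qed.

Section bounded_integrals.
Context d (T : measurableType d) (R : realType) (mu : {measure set T -> \bar R}).
Variables (f : T -> R) (c : R).
Hypotheses (mf : measurable_fun setT f) (fc : forall y, `|f y| <= c).

Lemma Rintegral_symdiff_le (D S E : set T) :
  measurable D -> measurable S -> measurable E ->
  (mu D < +oo)%E -> (mu S < +oo)%E -> (mu E < +oo)%E ->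
  (forall y, D y -> ~ S y -> E y) -> (forall y, S y -> ~ D y -> E y) ->
  `| \int[mu]_(y in D) f y - \int[mu]_(y in S) f y | <= c * fine (mu E).
Proof.
move=> mD mS mE Doo Soo Eoo DS SD.
have restr A : measurable A -> (mu A < +oo)%E ->
    mu.-integrable setT (EFin \o (f \_ A)).
  move=> mA Aoo; have := integrable_bounded mf fc mA Aoo.
  by move/(integrable_mkcond _ mA); rewrite restrict_EFin.
rewrite Rintegral_mkcond [X in _ - X]Rintegral_mkcond -RintegralB//; [|exact: restr..].
have iDS : mu.-integrable setT (EFin \o (fun y => (f \_ D) y - (f \_ S) y)).
  by rewrite /comp; under eq_fun do rewrite EFinB; apply: integrableB => //; exact: restr.
apply: le_trans (le_normr_Rintegral _ iDS) _ => //.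
have c0 : (mu E < +oo)%E -> mu.-integrable E (EFin \o cst c).
  by move=> Eoo'; apply: (@integrable_bounded _ _ _ _ _ `|c|).
rewrite -Rintegral_cst// [leRHS]Rintegral_mkcond; apply: le_Rintegral => //.
- have := integrable_abse iDS; rewrite /comp; by under eq_fun do rewrite abse_EFin.
- have := c0 Eoo; by move/(integrable_mkcond _ mE); rewrite restrict_EFin.
move=> y _; have c0' : 0 <= c by exact: le_trans (normr_ge0 _) (fc y).
rewrite !patchE; case: ifPn; rewrite ?(inE, notin_setE) => Dy;
  case: ifPn; rewrite ?(inE, notin_setE) => Sy.
- by rewrite subrr normr0; case: ifP.
- by rewrite ifT ?inE ?subr0//; exact: DS.
- by rewrite ifT ?inE ?sub0r ?normrN//; exact: SD.
- by rewrite subrr normr0; case: ifP.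
Qed.

Lemma Rintegral_ge_sub (D Q : set T) (a : R) :
  measurable D -> measurable Q -> (mu D < +oo)%E -> Q `<=` D ->
  (forall y, 0 <= f y) -> (forall y, Q y -> a <= f y) ->
  a * fine (mu Q) <= \int[mu]_(y in D) f y.
Proof.
move=> mD mQ Doo QD f0 fa.
have Qoo : (mu Q < +oo)%E.
  by apply: le_lt_trans Doo; apply: le_measure; rewrite ?inE.
rewrite -Rintegral_cst//; apply: (@le_trans _ _ (\int[mu]_(y in Q) f y)).
  apply: le_Rintegral => //; first exact: (@integrable_bounded _ _ _ _ _ `|a|).
  exact: integrable_bounded fc _ _.
rewrite /Rintegral fine_le//.
- by apply: integrable_fin_num => //; exact: integrable_bounded fc _ _.
- by apply: integrable_fin_num => //; exact: integrable_bounded fc _ _.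
apply: ge0_subset_integral => //; last by move=> y _; rewrite lee_fin.
by apply/measurable_EFinP; exact: measurable_funTS.
Qed.

End bounded_integrals.

Lemma Rintegral_frame (R : realType) (x n : pt R) (f : mR2 R -> mR R) (c : R)
    (D : set (mR2 R)) :
  enorm n = 1 -> measurable_fun setT f -> (forall y, `|f y| <= c) ->
  measurable D -> (leb2 D < +oo)%E ->
  Rintegral (@leb2 R) D f =
  Rintegral (@leb2 R) (frame x n @^-1` D) (f \o frame x n).
Proof.
move=> n1 mf fc mD Doo; rewrite /Rintegral; congr fine.
have mfr := measurable_frame x n.
have D'oo : (leb2 (frame x n @^-1` D) < +oo)%E by rewrite leb2_frame.
have mEf : measurable_fun setT (EFin \o f) by exact/measurable_EFinP.
have iEf : (@leb2 R).-integrable (frame x n @^-1` D) ((EFin \o f) \o frame x n).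
  apply: (integrable_bounded (f := f \o frame x n) (c := c)).
  - exact: measurableT_comp.
  - by move=> y; exact: fc.
  - exact: measurable_preimage.
  - exact: D'oo.
have H := integral_pushforward mfr mEf iEf mD.
apply: etrans H; apply: eq_measure_integral => A mA _.
exact: esym (leb2_frame _ n1 mA).
Qed.

(* Written as a [frame], so that [leb2_frame] applies to it. *)
Definition flip {R : realType} : mR2 R -> mR2 R := frame (0, 0) (0, 1).

Lemma flipE (R : realType) (z : mR2 R) : flip z = (- z.1, z.2).
Proof. by rewrite /flip /frame /perp /=; congr pair; ring. Qed.

(** In frame coordinates, reflecting the tangential axis preserves measure and domain and negates
    the integrand, so the integral equals its own opposite. *)
Lemma Rintegral_odd (R : realType) (x n : pt R) (f : mR2 R -> mR R) (c : R)
    (D : set (mR2 R)) :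
  enorm n = 1 -> measurable_fun setT f -> (forall y, `|f y| <= c) ->
  measurable D -> (leb2 D < +oo)%E ->
  (forall a b, D (frame x n (a, b)) -> D (frame x n (- a, b))) ->
  (forall a b, f (frame x n (- a, b)) = - f (frame x n (a, b))) ->
  Rintegral (@leb2 R) D f = 0.
Proof.
move=> n1 mf fc mD Doo Dflip fflip.
have mfr := measurable_frame x n.
have mD' : measurable (frame x n @^-1` D) by exact: measurable_preimage.
have D'oo : (leb2 (frame x n @^-1` D) < +oo)%E by rewrite leb2_frame.
have mf' : measurable_fun setT (f \o frame x n) by exact: measurableT_comp.
have e1 : enorm ((0, 1) : pt R) = 1.
  by rewrite /enorm /dot /= mulr0 mulr1 add0r sqrtr1.
rewrite (Rintegral_frame x n1 mf fc mD Doo); set I := Rintegral _ _ _.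
suff : I = - I by lra.
rewrite {1}/I (Rintegral_frame (0, 0) e1 mf' (fun y => fc _) mD' D'oo) -/flip.
have -> : flip @^-1` (frame x n @^-1` D) = frame x n @^-1` D.
  apply/seteqP; split=> -[a b]; rewrite /= flipE /=; last exact: Dflip.
  by move/Dflip; rewrite opprK.
rewrite -mulN1r /I -RintegralZl//; last first.
  by apply: (integrable_bounded (c := c)) => //; move=> y; exact: fc.
by apply: eq_Rintegral => -[a b] _; rewrite /= flipE fflip mulN1r.
Qed.

(** The parabola passes through the projection, at height [s] above [x]. The cut is on the
    tangential coordinate and not by the ball, so every normal section is an interval of length
    [2 * eta] whatever [kap] is. *)
Definition strip {R : realType} (x n : pt R) (s kap delta eta : R) : set (mR2 R) :=
  [set y | `|dot (vsub y x) (perp n)| <= delta /\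
   `|dot (vsub y x) n - s - kap * dot (vsub y x) (perp n) ^+ 2| <= eta].

Lemma dot_frame (R : realType) (x n : pt R) (z : mR2 R) : enorm n = 1 ->
  dot (vsub (frame x n z) x) n = z.2 /\ dot (vsub (frame x n z) x) (perp n) = z.1.
Proof.
move=> n1; have nn := dot_unit n1.
rewrite /dot /vsub /frame /perp /=; split.
  by transitivity (z.2 * (n.1 * n.1 + n.2 * n.2)); [ring|rewrite nn mulr1].
by transitivity (z.1 * (n.1 * n.1 + n.2 * n.2)); [ring|rewrite nn mulr1].
Qed.

Lemma measurable_dot_vsub (R : realType) (x u : pt R) :
  measurable_fun setT (fun y : mR2 R => dot (vsub y x) u : mR R).
Proof.
apply: (@measurableT_comp _ _ _ _ _ _ (fun z : mR2 R => dot z u : mR R) _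
  (fun y : mR2 R => vsub y x : mR2 R)); [exact: measurable_dot|exact: measurable_vsub].
Qed.

Lemma measurable_strip (R : realType) (x n : pt R) (s kap delta eta : R) :
  measurable (strip x n s kap delta eta).
Proof.
have mn (f : mR2 R -> mR R) (c : R) : measurable_fun setT f ->
    measurable [set y | `|f y| <= c].
  move=> mf; have -> : [set y | `|f y| <= c] = f @^-1` `[- c, c].
    by apply/seteqP; split => y; rewrite /= in_itv /= ler_norml.
  by apply: measurable_preimage mf _; exact: measurable_itv.
apply: measurableI.
  by apply: (mn (fun y => dot (vsub y x) (perp n))); exact: measurable_dot_vsub.
apply: (mn (fun y => dot (vsub y x) n - s - kap * dot (vsub y x) (perp n) ^+ 2)).
have mp := measurable_dot_vsub x (perp n).
have mq := measurable_dot_vsub x n.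
apply: measurable_funB; first exact: measurable_funB.
by apply: measurable_funM => //; exact: measurable_funX.
Qed.

Lemma leb2_strip (R : realType) (x n : pt R) (s kap delta eta : R) :
  enorm n = 1 -> 0 <= delta -> 0 <= eta ->
  (leb2 (strip x n s kap delta eta) <= (4 * delta * eta)%:E)%E.
Proof.
move=> n1 d0 e0; have ms := measurable_strip x n s kap delta eta.
rewrite -(leb2_frame x n1)//; set F := _ @^-1` _.
have mF : measurable F by apply: measurable_preimage ms; exact: measurable_frame.
pose I : set (mR R) := `[- delta, delta]%classic.
have mI : measurable I by exact: measurable_itv.
have secle u : (lebesgue_measure (xsection F u) <= (2 * eta * \1_I u)%:E)%E.
  have -> : xsection F u = if `|u| <= delta then
      `[s + kap * u ^+ 2 - eta, s + kap * u ^+ 2 + eta]%classic else set0.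
    apply/seteqP; split => v; rewrite /xsection /F /strip /= inE /=;
      have /= [-> ->] := dot_frame x (u, v) n1.
    - by case=> -> /ler_normlP[? ?] /=; rewrite in_itv /=; apply/andP; split; lra.
    - case: ifP => // ud; rewrite /= in_itv /= => /andP[? ?]; split => //.
      by apply/ler_normlP; split; lra.
  rewrite indicE mem_setE /I in_itv /= -ler_norml; case: ifP => _ /=.
    rewrite lebesgue_measure_itv /= lte_fin; case: ifP => _; rewrite -?EFinB lee_fin; lra.
  by rewrite measure0 mulr0.
rewrite /leb2 /product_measure1.
apply: (@le_trans _ _ (\int[lebesgue_measure]_u (2 * eta * \1_I u)%:E)%E).
  apply: ge0_le_integral => //.
  - exact: measurable_fun_xsection.
  - by apply/measurable_EFinP; apply: measurable_funM => //; exact: measurable_indic.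
  - by move=> u _; exact: secle.
under eq_integral do rewrite EFinM.
rewrite ge0_integralZl//; last 2 first.
  - by apply/measurable_EFinP; exact: measurable_indic.
  - by rewrite lee_fin mulr_ge0.
have leI : (lebesgue_measure I <= (2 * delta)%:E)%E.
  rewrite lebesgue_measure_itv /= lte_fin; case: ifP => _; rewrite -?EFinB lee_fin; lra.
rewrite integral_indic// setIT; apply: le_trans (lee_wpmul2l _ leI) _.
  by rewrite lee_fin mulr_ge0.
by rewrite -EFinM lee_fin; lra.
Qed.

Lemma leb2_square (R : realType) (a b l : R) : 0 < l ->
  leb2 ((`[a - l, a + l]%classic : set (mR R)) `*` (`[b - l, b + l]%classic : set (mR R)))
  = (4 * l ^+ 2)%:E.
Proof.
move=> l0; rewrite /leb2 product_measure1E; [|exact: measurable_itv..].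
have E c : lebesgue_measure (`[c - l, c + l]%classic : set (mR R)) = (2 * l)%:E.
  rewrite lebesgue_measure_itv /= lte_fin ifT; last by lra.
  by rewrite -EFinB; congr EFin; ring.
by rewrite [X in (X * _)%E]E [X in (_ * X)%E]E -EFinM; congr EFin; ring.
Qed.

(* If [q >= (delta / 8) ^+ 2] on a square of side [delta / 8] inside the ball,
   then [wint q] is at least
   [3 / (pi * delta ^+ 3) * delta^-1 * (delta / 8) ^+ 2 * (delta / 8) ^+ 2],
   and [pi <= 4]. *)
Definition inertia_const (R : realType) : R := 3 / (4 * 16 ^+ 3).

Lemma inertia_const_gt0 (R : realType) : 0 < inertia_const R.
Proof. by rewrite divr_gt0// mulr_gt0// exprn_gt0. Qed.

(** * Kernel-weighted integrals over the truncated ball *)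

Section weighted_integrals.
Variables (R : realType) (O : set (pt R)) (delta : R) (x : pt R).
Hypotheses (oO : open O) (delta0 : 0 < delta).

Let D : set (mR2 R) := Defs.ballE x delta `&` O.

Definition kfun (q : pt R -> R) (y : mR2 R) : mR R :=
  Kern delta (enorm (vsub y x)) * q (vsub y x).

(** Quadratic growth compensates the singularity of the kernel: the product is at most the distance
    to [x], hence at most [delta]. *)
Definition admissible (q : pt R -> R) : Prop :=
  measurable_fun setT (fun z : mR2 R => q z : mR R) /\
  forall z, `|q z| <= dot z z.

Lemma admissible_dot (u v : pt R) : enorm u = 1 -> enorm v = 1 ->
  admissible (fun z => dot z u * dot z v).
Proof.
move=> u1 v1; split.
  by apply: measurable_funM; exact: measurable_dot.
move=> z; rewrite normrM -enorm_sq expr2; apply: ler_pM => //; exact: normr_dot_unit.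
Qed.

Lemma measurable_kfun q : admissible q -> measurable_fun setT (kfun q).
Proof.
move=> [mq _]; have mv := measurable_vsub x; apply: measurable_funM.
  apply: (measurableT_comp (f := Kern delta) (g := fun y => enorm (vsub y x))).
    exact: measurable_Kern.
  by apply: measurableT_comp mv; exact: measurable_enorm.
exact: (measurableT_comp (f := fun z : mR2 R => q z : mR R) mq mv).
Qed.

Lemma kfun_le q : admissible q -> forall y, `|kfun q y| <= delta.
Proof.
move=> [_ qz] y; rewrite /kfun /Kern; case: ifPn => [/andP[r0 rd]|_]; last first.
  by rewrite mul0r normr0 ltW.
rewrite normrM gtr0_norm ?invr_gt0// ler_pdivrMl//.
by apply: le_trans (qz _) _; rewrite -enorm_sq expr2 ler_pM2l.
Qed.

Lemma measurable_domain : measurable D.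
Proof. by apply: measurableI; [exact: measurable_ballE|exact: open_measurable_prod]. Qed.

Lemma domain_lty (A : set (mR2 R)) : measurable A -> A `<=` Defs.ballE x delta ->
  (leb2 A < +oo)%E.
Proof.
move=> mA AB; apply: le_lt_trans (leb2_ballE_lty x delta).
by apply: le_measure; rewrite ?inE//; exact: measurable_ballE.
Qed.

Lemma domain_sub : D `<=` Defs.ballE x delta. Proof. by move=> y []. Qed.

Lemma wintE q : wint O delta x q = 2 / mvol delta * Rintegral (@leb2 R) D (kfun q).
Proof. by []. Qed.

Lemma wint_comb (q1 q2 q3 : pt R -> R) (a b c : R) :
  admissible q1 -> admissible q2 -> admissible q3 ->
  wint O delta x (fun z => a * q1 z + b * q2 z + c * q3 z) =
  a * wint O delta x q1 + b * wint O delta x q2 + c * wint O delta x q3.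
Proof.
move=> a1 a2 a3; rewrite !wintE.
have mD := measurable_domain; have Doo := domain_lty mD domain_sub.
have int q : admissible q -> (@leb2 R).-integrable D (EFin \o kfun q).
  move=> aq; apply: integrable_bounded (kfun_le aq) mD Doo.
  exact: measurable_kfun.
have intZ q k : admissible q -> (@leb2 R).-integrable D (EFin \o (fun y => k * kfun q y)).
  by move=> aq; have := integrableZl mD k (int q aq).
have -> : Rintegral (@leb2 R) D (kfun (fun z => a * q1 z + b * q2 z + c * q3 z)) =
    Rintegral (@leb2 R) D (fun y => a * kfun q1 y + b * kfun q2 y + c * kfun q3 y).
  by apply: eq_Rintegral => y _; rewrite /kfun; ring.
rewrite RintegralD//; last 2 first.
- by have := integrableD mD (intZ q1 a a1) (intZ q2 b a2).
- exact: intZ.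
rewrite RintegralD//; [|exact: intZ..].
by rewrite !RintegralZl//; [ring|exact: int..].
Qed.

Lemma mvol_gt0 : 0 < mvol delta.
Proof.
have pi0 := pi_gt0 R; have d3 : 0 < delta ^+ 3 by exact: exprn_gt0.
by rewrite /mvol divr_gt0// !mulr_gt0.
Qed.

(** * Cross and diagonal terms at a point close to the boundary *)

Section near_boundary.
Variables (nv : pt R) (s C : R).
Hypotheses (C1 : 1 <= C) (s0 : 0 < s) (sd : s < delta) (dC : 40 * C * delta <= 1).
Hypothesis nv1 : enorm nv = 1.
Hypothesis O_tube : tube O C (vadd x s nv) nv.

Let a (y : mR2 R) : R := dot (vsub y x) (perp nv).
Let n (y : mR2 R) : R := dot (vsub y x) nv.

(** The ball about [x] lies within [2 * delta] of the projection, whence the factor 8 = 2^3; [dC]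
    keeps this inside the radius [C^-1] of the tube. *)
Lemma tube_ball : exists kap : R, `|kap| <= C /\ forall y, Defs.ballE x delta y ->
  (O y -> n y - s - kap * a y ^+ 2 <= 8 * C * delta ^+ 3) /\
  (~ O y -> - (8 * C * delta ^+ 3) <= n y - s - kap * a y ^+ 2).
Proof.
move: (delta0) (C1) (s0) (sd) (dC) => ? ? ? ? ?.
have [kap [kapC H]] := O_tube; exists kap; split => // y yx.
have nn := dot_unit nv1.
have yn : dot (vsub y (vadd x s nv)) nv = n y - s.
  transitivity (n y - s * (nv.1 * nv.1 + nv.2 * nv.2)); last by rewrite nn mulr1.
  by rewrite /n /dot /vsub /vadd /=; ring.
have yp : dot (vsub y (vadd x s nv)) (perp nv) = a y.
  by rewrite /a /dot /vsub /vadd /perp /=; ring.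
have yd : enorm (vsub y (vadd x s nv)) <= 2 * delta.
  apply: le_trans (enorm_triangle y x _) _.
  have : enorm (vsub x (vadd x s nv)) <= s.
    apply: enorm_le; first exact: ltW.
    rewrite (_ : dot _ _ = s ^+ 2 * (nv.1 * nv.1 + nv.2 * nv.2)).
      by rewrite nn mulr1.
    by rewrite /dot /vsub /vadd /=; ring.
  by move=> h; apply: le_trans (lerD yx h) _; lra.
have C0 : 0 < C by lra.
have ydC : enorm (vsub y (vadd x s nv)) <= C^-1.
  by apply: le_trans yd _; rewrite -[leRHS]mul1r ler_pdivlMr//; nra.
have y3 : C * enorm (vsub y (vadd x s nv)) ^+ 3 <= 8 * C * delta ^+ 3.
  rewrite (_ : 8 * C * delta ^+ 3 = C * (2 * delta) ^+ 3); last by ring.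
  apply: ler_wpM2l; first exact: ltW.
  by apply: lerXn2r => //; rewrite nnegrE ?enorm_ge0//; lra.
have := H y ydC; rewrite yn yp => -[Hin Hout].
by split => [/Hin|/Hout]; lra.
Qed.

Lemma wint_cross_le :
  `|wint O delta x (fun z => dot z (perp nv) * dot z nv)| <= 48 * C * delta ^+ 2.
Proof.
move: (delta0) (C1) (s0) (sd) (dC) => ? ? ? ? ?.
have [kap [kapC H]] := tube_ball.
have p1 : enorm (perp nv) = 1 by rewrite enorm_perp.
set q := fun z => _; have aq : admissible q by exact: admissible_dot.
have mD := measurable_domain; have Doo := domain_lty mD domain_sub.
pose S : set (mR2 R) := Defs.ballE x delta `&`
  [set y | n y - s - kap * a y ^+ 2 < 0].
have mS : measurable S.
  apply: measurableI; first exact: measurable_ballE.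
  apply: (@measurable_sublevel R (fun y => n y - s - kap * a y ^+ 2)).
  have mp := measurable_dot_vsub x (perp nv).
  have mn := measurable_dot_vsub x nv.
  apply: measurable_funB; first exact: measurable_funB.
  by apply: measurable_funM => //; exact: measurable_funX.
have Soo : (leb2 S < +oo)%E by apply: domain_lty => // y [].
have S0 : Rintegral (@leb2 R) S (kfun q) = 0.
  have enormE (z z' : pt R) : dot z z = dot z' z' -> enorm z = enorm z'.
    by rewrite /enorm => ->.
  have nn := dot_unit nv1.
  (* Tangential reflection preserves the distance to [x], hence both ball and kernel, and the
     parabola involves only the square of the tangential coordinate. *)
  have refl b c : enorm (vsub (frame x nv (- b, c)) x) = enorm (vsub (frame x nv (b, c)) x).
    by apply: enormE; rewrite /dot /vsub /frame /perp /=; ring.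
  apply: (Rintegral_odd (x := x) nv1 (measurable_kfun aq) (kfun_le aq) mS Soo) => b c.
    case; rewrite /Defs.ballE /= -(refl b c) => Bb.
    have [e1 e2] := dot_frame x (b, c) nv1; have [e3 e4] := dot_frame x (- b, c) nv1.
    by rewrite /n /a e1 e2 => Sb; split; rewrite /Defs.ballE //= /n /a e3 e4 sqrrN.
  rewrite /kfun refl /q.
  have [e1 e2] := dot_frame x (b, c) nv1; have [e3 e4] := dot_frame x (- b, c) nv1.
  by rewrite e1 e2 e3 e4 /=; ring.
pose eta := 8 * C * delta ^+ 3.
have d3 : 0 < delta ^+ 3 by exact: exprn_gt0.
have eta0 : 0 <= eta by rewrite /eta !mulr_ge0 ?ltW//; lra.
pose E := strip x nv s kap delta eta.
have mE : measurable E by exact: measurable_strip.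
have leE : (leb2 E <= (4 * delta * eta)%:E)%E by apply: leb2_strip => //; exact: ltW.
have Eoo : (leb2 E < +oo)%E by apply: le_lt_trans leE _; exact: ltry.
have aball y : Defs.ballE x delta y -> `|a y| <= delta.
  by move=> yx; apply: le_trans yx; apply: normr_dot_unit.
have IE : `|Rintegral (@leb2 R) D (kfun q)| <= delta * (4 * delta * eta).
  rewrite -[X in `|X|]subr0 -S0.
  apply: le_trans (Rintegral_symdiff_le (measurable_kfun aq) (kfun_le aq)
    mD mS mE Doo Soo Eoo _ _) _.
  - move=> y [yx Oy] nSy; split; first exact: aball.
    have [/(_ Oy) ? _] := H y yx; have ? : 0 <= n y - s - kap * a y ^+ 2.
      by rewrite leNgt; apply/negP => ?; apply: nSy.
    by rewrite ger0_norm.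
  - move=> y [yx /= Sy] nDy; split; first exact: aball.
    have [_ Hy] := H y yx; have Hy' := Hy (fun Oy => nDy (conj yx Oy)).
    by rewrite ltr0_norm// lerNl.
  apply: ler_wpM2l; first exact: ltW.
  have := fine_le _ _ leE; rewrite /=; apply => //.
  by rewrite ge0_fin_numE.
rewrite wintE normrM.
have m0 := mvol_gt0; rewrite ger0_norm; last by rewrite divr_ge0// ltW.
rewrite mulrAC ler_pdivrMr//.
have pi2 := pi_ge2 R.
have d5 : 0 <= C * delta ^+ 5 by rewrite mulr_ge0 ?exprn_ge0//; lra.
(* The integral is at most 32 C delta^5; multiplying by 2 / m(delta) = 3 / (pi delta^3) gives 96 C
   delta^2 / pi, and pi >= 2 yields 48. *)
have -> : 48 * C * delta ^+ 2 * mvol delta = 32 * pi * (C * delta ^+ 5).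
  by rewrite /mvol; field.
move: IE; have -> : delta * (4 * delta * eta) = 32 * (C * delta ^+ 5).
  by rewrite /eta; ring.
have : 2 * (C * delta ^+ 5) <= pi * (C * delta ^+ 5) by apply: ler_wpM2r.
by move: `|_| => I; lra.
Qed.

Lemma wint_square_ge (q : pt R -> R) : admissible q -> (forall z, 0 <= q z) ->
  (forall z, delta / 8 <= dot z (perp nv) -> dot z nv <= - (delta / 8) ->
     (delta / 8) ^+ 2 <= q z) ->
  inertia_const R <= wint O delta x q.
Proof.
move: (delta0) (C1) (s0) (sd) (dC) => ? ? ? ? ?.
move=> aq q0 q8; have [kap [kapC H]] := tube_ball.
have p1 : enorm (perp nv) = 1 by rewrite enorm_perp.
have nn := dot_unit nv1.
have mD := measurable_domain; have Doo := domain_lty mD domain_sub.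
pose l := delta / 16; have l0 : 0 < l by rewrite /l; lra.
(* Centre [delta / 4] along the tangent and [delta / 2] inward: both frame coordinates stay at least
   [delta / 8] in size, so one square serves both diagonal entries. The square is parallel to the
   coordinate axes, so its measure is a product; its half-diagonal is below [delta / 8] in every
   frame. *)
pose c : pt R := (delta * ((perp nv).1 / 4 - nv.1 / 2), delta * ((perp nv).2 / 4 - nv.2 / 2)).
pose Q : set (mR2 R) :=
  (`[x.1 + c.1 - l, x.1 + c.1 + l]%classic : set (mR R)) `*`
  (`[x.2 + c.2 - l, x.2 + c.2 + l]%classic : set (mR R)).
have mQ : measurable Q by apply: measurableX; exact: measurable_itv.
have Qy y : Q y -> [/\ delta / 8 <= a y, a y <= 3 / 8 * delta,
    - (5 / 8 * delta) <= n y & n y <= - (3 / 8 * delta)].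
  case; rewrite /= !in_itv /= => /andP[y1 y1'] /andP[y2 y2'].
  pose w := vsub (vsub y x) c.
  have wd : enorm w <= delta / 8.
    by apply: enorm_le; rewrite /w /dot /vsub /=; move: y1 y1' y2 y2'; rewrite /l; nra.
  have aw : a y = delta / 4 + dot w (perp nv).
    transitivity (delta / 4 * (nv.1 * nv.1 + nv.2 * nv.2) + dot w (perp nv)).
      by rewrite /a /w /dot /vsub /perp /=; field.
    by rewrite nn mulr1.
  have nw : n y = - (delta / 2) + dot w nv.
    transitivity (- (delta / 2) * (nv.1 * nv.1 + nv.2 * nv.2) + dot w nv).
      by rewrite /n /w /dot /vsub /perp /=; field.
    by rewrite nn mulr1.
  have /ler_normlP[? ?] := le_trans (normr_dot_unit w p1) wd.
  have /ler_normlP[? ?] := le_trans (normr_dot_unit w nv1) wd.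
  by rewrite aw nw; split; lra.
have Qball y : Q y -> Defs.ballE x delta y.
  move=> /Qy[a1 a2 n1 n2]; apply: enorm_le; first exact: ltW.
  have -> : dot (vsub y x) (vsub y x) = a y ^+ 2 + n y ^+ 2.
    transitivity (dot (vsub y x) (vsub y x) * (nv.1 * nv.1 + nv.2 * nv.2)).
      by rewrite nn mulr1.
    by rewrite /a /n /dot /vsub /perp /=; ring.
  nra.
have QD : Q `<=` D.
  move=> y Qyy; split; first exact: Qball.
  (* On the square the curved coordinate is at most - 3/8 delta + delta / 40, below the threshold -
     delta / 40 that a point outside [O] would have to reach. *)
  apply: contrapT => nOy; have [_ /(_ nOy)] := H y (Qball y Qyy).
  have [a1 a2 n1 n2] := Qy y Qyy.
  have a22 : a y ^+ 2 <= delta ^+ 2 by apply: lerXn2r; rewrite ?nnegrE; lra.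
  have ka : - (C * delta ^+ 2) <= kap * a y ^+ 2.
    have /ler_normlP[? ?] := kapC.
    have : 0 <= (C + kap) * a y ^+ 2 by rewrite mulr_ge0 ?sqr_ge0//; lra.
    have : C * a y ^+ 2 <= C * delta ^+ 2 by apply: ler_wpM2l => //; lra.
    lra.
  have Cd2 : C * delta ^+ 2 <= delta / 40 by nra.
  have d40 : delta <= 1 / 40 by nra.
  have Cd3 : 8 * C * delta ^+ 3 <= delta / 40 by rewrite exprSr; nra.
  lra.
have kq y : Q y -> delta / 64 <= kfun q y.
  move=> Qyy; have [a1 a2 n1 n2] := Qy y Qyy.
  have qy : (delta / 8) ^+ 2 <= q (vsub y x) by apply: q8; rewrite -/(a y) -/(n y); lra.
  have e0 : 0 < enorm (vsub y x).
    by apply: lt_le_trans (normr_dot_unit (vsub y x) p1); rewrite normr_gt0 -/(a y) gt_eqF; lra.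
  have ed := Qball y Qyy; rewrite /Defs.ballE /= in ed.
  rewrite /kfun /Kern e0 ed /= ler_pdivlMl//.
  apply: le_trans qy; rewrite (_ : (delta / 8) ^+ 2 = delta * (delta / 64)); last by field.
  by apply: ler_wpM2r => //; lra.
have k0 y : 0 <= kfun q y.
  by rewrite /kfun /Kern; case: ifPn => [/andP[r0 _]|_]; rewrite ?mul0r// mulr_ge0// invr_ge0 ltW.
have := Rintegral_ge_sub (measurable_kfun aq) (kfun_le aq) mD mQ Doo QD k0 kq.
have -> : fine (leb2 Q) = 4 * l ^+ 2 by rewrite /Q leb2_square.
move=> IQ; rewrite /inertia_const wintE mulrAC ler_pdivlMr ?mvol_gt0//.
have pi4 : pi <= 4 :> R by have := pihalf_lt2 R; lra.
have d3 : 0 <= (delta / 16) ^+ 3 by rewrite exprn_ge0// divr_ge0// ltW.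
have IQ' : (delta / 16) ^+ 3 <= Rintegral (@leb2 R) D (kfun q).
  by apply: le_trans IQ; rewrite /l le_eqVlt; apply/orP; left; apply/eqP; field.
have -> : 3 / (4 * 16 ^+ 3) * mvol delta = 2 * (pi / 4 * (delta / 16) ^+ 3).
  by rewrite /mvol; field.
rewrite ler_pM2l//; apply: le_trans IQ'.
by rewrite ler_piMl// ler_pdivrMr// mul1r.
Qed.

End near_boundary.

End weighted_integrals.

(** * Inversion of the 2x2 matrix *)

Section inverse2.
Variable R : realType.
Implicit Types (A : 'M[R]_2) (u v n : pt R).

Let i0 : 'I_2 := ord0.
Let i1 : 'I_2 := lift ord0 ord0.

Lemma bilE A u v : bil A u v =
  u.1 * v.1 * A i0 i0 + u.1 * v.2 * A i0 i1 + u.2 * v.1 * A i1 i0 + u.2 * v.2 * A i1 i1.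
Proof.
rewrite /bil !mxE !big_ord_recl big_ord0 !mxE !big_ord_recl !big_ord0 !mxE /coord /=.
by rewrite -/i0 -/i1; ring.
Qed.

Lemma invmx2_sym A : A i1 i0 = A i0 i1 ->
  let d := A i0 i0 * A i1 i1 - A i0 i1 ^+ 2 in d != 0 ->
  A \in unitmx /\ invmx A = \matrix_(i, j)
    ((if i == j then (if i == i0 then A i1 i1 else A i0 i0) else - A i0 i1) / d).
Proof.
move=> As d d0; set B : 'M[R]_2 := \matrix_(i, j) _.
have AB : A *m B = 1%:M.
  apply/matrixP => i j; rewrite !mxE !big_ord_recl big_ord0 !mxE -/i0 -/i1.
  have ord2 (k : 'I_2) : k = i0 \/ k = i1.
    by case: k => [[|[|k]]] // kP; [left|right]; apply: val_inj.
  by case: (ord2 i) => ->; case: (ord2 j) => -> /=; rewrite ?As;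
    move: d0; rewrite /d => d0; field.
have [uA _] := mulmx1_unit AB; split => //.
by rewrite -[RHS](mulKmx uA) AB mulmx1.
Qed.

(** [c] bounds the diagonal from below and [k] bounds the cross term. The condition [k <= c / 2]
    keeps the determinant above [c ^+ 2 / 2], which produces the factors 2 in the bounds. *)
Lemma inverse_estimate A n (c k : R) :
  let app := bil A (perp n) (perp n) in
  let ann := bil A n n in
  let apn := bil A (perp n) n in
  let M := invmx A in
  A i1 i0 = A i0 i1 -> enorm n = 1 -> 0 < c -> c <= app -> c <= ann ->
  `|apn| <= k -> k <= c / 2 ->
  A \in unitmx /\ M^T = M /\
  `|bil M (perp n) (perp n) - app^-1| <= 2 * k ^+ 2 / c ^+ 3 /\
  `|bil M (perp n) n| <= 2 * k / c ^+ 2 /\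
  `|bil M n (perp n)| <= 2 * k / c ^+ 2 /\
  `|bil M n n - ann^-1| <= 2 * k ^+ 2 / c ^+ 3.
Proof.
move=> app ann apn M As n1 c0 capp cann apnk kc.
have nn := dot_unit n1.
pose d := A i0 i0 * A i1 i1 - A i0 i1 ^+ 2.
(* The determinant is invariant under a change of orthonormal frame; the factor inserted is the
   fourth power of the length of [n]. *)
have dE : d = app * ann - apn ^+ 2.
  transitivity (d * (n.1 * n.1 + n.2 * n.2) ^+ 2); first by rewrite nn expr1n mulr1.
  by rewrite /d /app /ann /apn !bilE As /perp /=; ring.
have k0 : 0 <= k by exact: le_trans apnk.
have apn2 : apn ^+ 2 <= k ^+ 2.
  by rewrite -(ger0_norm (sqr_ge0 apn)) normrX; apply: lerXn2r; rewrite ?nnegrE.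
have k2 : k ^+ 2 <= c ^+ 2 / 4.
  by rewrite (_ : c ^+ 2 / 4 = (c / 2) ^+ 2); [apply: lerXn2r; rewrite ?nnegrE//; lra|field].
have cc : c ^+ 2 <= app * ann by rewrite expr2; apply: ler_pM => //; exact: ltW.
have c2 : 0 < c ^+ 2 by exact: exprn_gt0.
have dc : c ^+ 2 / 2 <= d by rewrite dE; lra.
have d0 : 0 < d by lra.
have app0 : 0 < app by lra.
have ann0 : 0 < ann by lra.
have [uA ME] : A \in unitmx /\ _ := invmx2_sym As (lt0r_neq0 d0).
(* The adjugate of a symmetric 2x2 matrix is its conjugate by the quarter turn [perp], which swaps
   the two diagonal entries in the frame and negates the cross term. *)
have Mpp : bil M (perp n) (perp n) = ann / d.
  by rewrite bilE /M ME !mxE /= /ann bilE As /perp /=; rewrite -/d; field; rewrite gt_eqF.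
have Mnn : bil M n n = app / d.
  by rewrite bilE /M ME !mxE /= /app bilE As /perp /=; rewrite -/d; field; rewrite gt_eqF.
have Mpn : bil M (perp n) n = - (apn / d).
  by rewrite bilE /M ME !mxE /= /apn bilE As /perp /=; rewrite -/d; field; rewrite gt_eqF.
have Mnp : bil M n (perp n) = - (apn / d).
  by rewrite bilE /M ME !mxE /= /apn bilE As /perp /=; rewrite -/d; field; rewrite gt_eqF.
have diag (a : R) : c <= a -> `|apn ^+ 2 / (a * d)| <= 2 * k ^+ 2 / c ^+ 3.
  move=> ca; have ad : c ^+ 3 / 2 <= a * d.
    rewrite (_ : c ^+ 3 / 2 = c * (c ^+ 2 / 2)); last by rewrite exprS mulrA.
    by apply: ler_pM => //; lra.
  have c3 : 0 < c ^+ 3 by exact: exprn_gt0.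
  have ad0 : 0 < a * d by lra.
  rewrite ger0_norm; last by rewrite divr_ge0// ?sqr_ge0// ltW.
  rewrite ler_pdivrMr// mulrAC ler_pdivlMr//.
  have : apn ^+ 2 * c ^+ 3 <= k ^+ 2 * (2 * (a * d)).
    by apply: ler_pM => //; [exact: sqr_ge0|exact: ltW|lra].
  lra.
have off : `|- (apn / d)| <= 2 * k / c ^+ 2.
  rewrite normrN normrM normfV (gtr0_norm d0) ler_pdivrMr// mulrAC ler_pdivlMr//.
  have : `|apn| * c ^+ 2 <= k * (2 * d) by apply: ler_pM => //; lra.
  lra.
split => //; split.
  apply/matrixP => i j; rewrite /M ME !mxE [j == i]eq_sym.
  by case: eqP => [->|].
rewrite Mpn Mnp Mpp Mnn; split; last split => //; last split => //.
- have -> : ann / d - app^-1 = apn ^+ 2 / (app * d); last exact: diag.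
  have -> : apn ^+ 2 = app * ann - d by rewrite dE; ring.
  by field; rewrite !gt_eqF.
- have -> : app / d - ann^-1 = apn ^+ 2 / (ann * d); last exact: diag.
  have -> : apn ^+ 2 = app * ann - d by rewrite dE; ring.
  by field; rewrite !gt_eqF.
Qed.

End inverse2.

(** * From coordinate entries to the normal frame, and the final constants *)

Lemma bil_Amat (R : realType) (O : set (pt R)) (delta : R) (x u v : pt R) :
  open O -> 0 < delta ->
  bil (Amat O delta x) u v = wint O delta x (fun z => dot z u * dot z v).
Proof.
move=> oO d0.
have e1 : enorm ((1, 0) : pt R) = 1 by rewrite /enorm /dot /= mulr1 mulr0 addr0 sqrtr1.
have e2 : enorm ((0, 1) : pt R) = 1 by rewrite /enorm /dot /= mulr1 mulr0 add0r sqrtr1.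
have dot1 z : dot z ((1, 0) : pt R) = z.1 by rewrite /dot /= mulr1 mulr0 addr0.
have dot2 z : dot z ((0, 1) : pt R) = z.2 by rewrite /dot /= mulr1 mulr0 add0r.
have a11 : admissible (fun z : pt R => z.1 * z.1).
  by have := admissible_dot e1 e1; under eq_fun do rewrite !dot1.
have a12 : admissible (fun z : pt R => z.1 * z.2).
  by have := admissible_dot e1 e2; under eq_fun do rewrite !dot1 !dot2.
have a22 : admissible (fun z : pt R => z.2 * z.2).
  by have := admissible_dot e2 e2; under eq_fun do rewrite !dot2.
rewrite (_ : (fun z => _) = fun z : pt R => u.1 * v.1 * (z.1 * z.1) +
   (u.1 * v.2 + u.2 * v.1) * (z.1 * z.2) + u.2 * v.2 * (z.2 * z.2)); last first.
  by apply/funext => z; rewrite /dot; ring.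
rewrite (wint_comb x oO d0 _ _ _ a11 a12 a22) bilE !mxE /coord /=.
rewrite (_ : (fun z : pt R => z.2 * z.1) = fun z : pt R => z.1 * z.2); first by ring.
by apply/funext => z; rewrite mulrC.
Qed.

Theorem theorem1 (R : realType) (Omega GammaD GammaN : set (pt R)) :
  C3_bounded_domain Omega ->
  GammaD `|` GammaN = boundary Omega ->
  exists (dbar C : R), 0 < dbar /\ 0 < C /\
  forall (delta : R) (x xb nv : pt R) (s : R),
    0 < delta -> delta <= dbar ->
    Omega x ->
    (* xb is the (orthogonal) projection of x onto GammaN ... *)
    GammaN xb ->
    (forall y, GammaN y -> enorm (vsub x xb) <= enorm (vsub x y)) ->
    (* ... with xb - x = s_x n(xb), 0 < s_x < delta, n(xb) the outward unit normal *)
    outward_unit_normal Omega xb nv ->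
    xb = vadd x s nv -> 0 < s -> s < delta ->
    let A := Amat Omega delta x in
    let pv := perp nv in
    let app := wint Omega delta x (fun z => dot z pv ^+ 2) in
    let ann := wint Omega delta x (fun z => dot z nv ^+ 2) in
    let apn := wint Omega delta x (fun z => dot z pv * dot z nv) in
    let M := invmx A in
    A \in unitmx /\
    M^T = M /\
    `|apn| <= C * delta ^+ 2 /\
    `|bil M pv pv - app^-1| <= C * delta ^+ 4 /\
    `|bil M pv nv| <= C * delta ^+ 2 /\
    `|bil M nv pv| <= C * delta ^+ 2 /\
    `|bil M nv nv - ann^-1| <= C * delta ^+ 4.
Proof.
move=> OmegaC3 _; have [_ [oO _]] := OmegaC3.
have [C0 [C00 HC0]] := uniform_tube OmegaC3.
pose C := C0 + 1.
have C1 : 1 <= C by rewrite /C; lra.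
have HC b nv : outward_unit_normal Omega b nv -> tube Omega C b nv.
  by move=> /HC0; apply: tube_le => //; rewrite /C; lra.
move: C C1 HC => C C1 HC {C0 C00 HC0}.
have c0 := inertia_const_gt0 R; set c := inertia_const R in c0.
have C40 : 0 < 40 * C by lra.
have Cc2 : 0 <= 96 * C / c ^+ 2 by rewrite divr_ge0 ?exprn_ge0//; lra.
have Cc3 : 0 <= 2 * (48 * C) ^+ 2 / c ^+ 3.
  by apply: divr_ge0; [rewrite mulr_ge0 ?sqr_ge0|exact/exprn_ge0/ltW].
(* Both bounds on [delta] together give 48 C delta^2 <= 6/5 delta <= c / 2, as [inverse_estimate]
   requires with k = 48 C delta^2. The three summands of the constant are the coefficients for a_pn,
   for 2 k / c^2 and for 2 k^2 / c^3. *)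
exists (Num.min (40 * C)^-1 (c / 4)), (48 * C + 96 * C / c ^+ 2 + 2 * (48 * C) ^+ 2 / c ^+ 3).
split; first by rewrite lt_min invr_gt0 C40 divr_gt0.
split; first by lra.
move=> delta x xb nv s d0; rewrite le_min => /andP[dC dc] _ _ _ onv xbE s0 sd A pv app ann apn M.
have nv1 : enorm nv = 1 by case: onv => _ [].
have p1 : enorm pv = 1 by rewrite enorm_perp.
have {}dC : 40 * C * delta <= 1 by move: dC; rewrite -[(40 * C)^-1]mul1r ler_pdivlMr// mulrC.
have Otube : tube Omega C (vadd x s nv) nv by rewrite -xbE; exact: HC.
have d2 : 0 <= delta ^+ 2 by exact: sqr_ge0.
have d4 : 0 <= delta ^+ 4 by exact: exprn_ge0 (ltW d0).
have bilA u v := bil_Amat x u v oO d0.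
have appE : app = bil A pv pv by rewrite bilA; congr wint; apply/funext => z; rewrite expr2.
have annE : ann = bil A nv nv by rewrite bilA; congr wint; apply/funext => z; rewrite expr2.
have apnE : apn = bil A pv nv by rewrite bilA.
have apnle : `|apn| <= 48 * C * delta ^+ 2.
  exact: (@wint_cross_le _ _ _ x oO d0 nv s C C1 s0 sd dC nv1 Otube).
have sq u : enorm u = 1 -> admissible (fun z => dot z u ^+ 2).
  by move=> u1; have := admissible_dot u1 u1; under eq_fun do rewrite -expr2.
have low q := @wint_square_ge _ _ _ x oO d0 nv s C C1 s0 sd dC nv1 Otube q.
have capp : c <= app.
  apply: (low (fun z => dot z pv ^+ 2)) => [|z|z zp _]; first exact: sq.
    exact: sqr_ge0.
  by apply: lerXn2r; rewrite ?nnegrE//; lra.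
have cann : c <= ann.
  apply: (low (fun z => dot z nv ^+ 2)) => [|z|z _ zn]; first exact: sq.
    exact: sqr_ge0.
  by rewrite -[leRHS]sqrrN; apply: lerXn2r; rewrite ?nnegrE; lra.
have kc : 48 * C * delta ^+ 2 <= c / 2.
  have : 40 * C * delta * delta <= 1 * delta by apply: ler_wpM2r; lra.
  rewrite expr2; lra.
have As : A (lift ord0 ord0) ord0 = A ord0 (lift ord0 ord0).
  by rewrite !mxE; congr wint; apply/funext => z; rewrite mulrC.
rewrite appE in capp *; rewrite annE in cann *; rewrite apnE in apnle *.
have [uA [MT [h1 [h2 [h3 h4]]]]] := inverse_estimate As nv1 c0 capp cann apnle kc.
have le4 : 2 * (48 * C * delta ^+ 2) ^+ 2 / c ^+ 3 <=
    (48 * C + 96 * C / c ^+ 2 + 2 * (48 * C) ^+ 2 / c ^+ 3) * delta ^+ 4.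
  have -> : 2 * (48 * C * delta ^+ 2) ^+ 2 / c ^+ 3 =
    2 * (48 * C) ^+ 2 / c ^+ 3 * delta ^+ 4 by field; rewrite gt_eqF.
  by apply: ler_wpM2r => //; lra.
have le2 : 2 * (48 * C * delta ^+ 2) / c ^+ 2 <=
    (48 * C + 96 * C / c ^+ 2 + 2 * (48 * C) ^+ 2 / c ^+ 3) * delta ^+ 2.
  have -> : 2 * (48 * C * delta ^+ 2) / c ^+ 2 = 96 * C / c ^+ 2 * delta ^+ 2.
    by field; rewrite gt_eqF.
  by apply: ler_wpM2r => //; lra.
have le0 : 48 * C * delta ^+ 2 <=
    (48 * C + 96 * C / c ^+ 2 + 2 * (48 * C) ^+ 2 / c ^+ 3) * delta ^+ 2.
  by apply: ler_wpM2r => //; lra.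
split => //; split => //; split; first exact: le_trans le0.
split; first exact: le_trans le4.
split; first exact: le_trans le2.
by split; [exact: le_trans le2|exact: le_trans le4].
Qed.
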